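(* Bounded cost satisfiability (BCS) for $\mathcal{ALCO}$ weighted knowledge bases is in NP in data complexity, even with a binary encoding of the weights.
   Context: Fix pairwise disjoint countably infinite sets $\mathsf{N_C}$, $\mathsf{N_R}$, $\mathsf{N_I}$ of concept, role and individual names. $\mathcal{ALCO}$ concepts: $C ::= A \mid \{a\} \mid \top \mid \bot \mid C\sqcap C \mid C\sqcup C \mid \neg C \mid \exists R.C \mid \forall R.C$. A TBox is a finite set of concept inclusions $C\sqsubseteq D$; an ABox is a finite set of assertions $A(a)$, $R(a,b)$. Interpretations $\mathcal I=(\Delta^{\mathcal I},\cdot^{\mathcal I})$ have the usual semantics under a weak standard names assumption: individual names occurring in the input are interpreted as themselves, $a^{\mathcal I}=a\in\Delta^{\mathcal I}$, while $\Delta^{\mathcal I}$ need not contain all of $\mathsf{N_I}$. A weighted knowledge base (WKB) is $\mathcal K_\omega=(\langle\mathcal T,\mathcal A\rangle,\omega)$ with $\omega:\mathcal T\cup\mathcal A\to\mathbb N_{>0}\cup\{\infty\}$. For $\tau=B\sqsubseteq C$ let $\mathrm{vio}_\tau(\mathcal I)=(B\sqcap\neg C)^{\mathcal I}$ and $\mathrm{vio}_{\mathcal A}(\mathcal I)=\{\alpha\in\mathcal A\mid\mathcal I\not\models\alpha\}$. $\mathrm{cost}_{\mathcal K_\omega}(\mathcal I)=\sum_{\tau\in\mathcal T}\omega(\tau)|\mathrm{vio}_\tau(\mathcal I)|+\sum_{\alpha\in\mathrm{vio}_{\mathcal A}(\mathcal I)}\omega(\alpha)$ (summands with empty violation set are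 $0$; cost $\infty$ if an infinite-weight element is violated or some violation set is infinite). BCS: given $\mathcal K_\omega$ and integer $k$, decide whether some $\mathcal I$ has cost $\le k$. Data complexity measures complexity only in the size of the weighted ABox $\{(\alpha,\omega(\alpha))\mid\alpha\in\mathcal A\}$, with the TBox, its weights and $k$ fixed. *)

(* Defs.v *)
From Corelib Require Export BinNums.
From HB Require Import structures.
From mathcomp Require Export all_boot all_order all_algebra.
From mathcomp Require Export boolp classical_sets functions cardinality.
From mathcomp Require Export constructive_ereal.

Set Implicit Arguments.
Unset Strict Implicit.
Unset Printing Implicit Defensive.

Local Open Scope classical_set_scope.

(** * Nondeterministic multi-tape Turing machines and NP *)

Variant move := MoveL | MoveR | Stay.

Definition move_code (d : move) : 'I_3 :=
  inord (match d with MoveL => 0 | MoveR => 1 | Stay => 2 end).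
Definition move_decode (i : 'I_3) : option move :=
  onth [:: MoveL; MoveR; Stay] i.
Lemma move_codeK : pcancel move_code move_decode.
Proof. by case; rewrite /move_decode /move_code inordK. Qed.
HB.instance Definition _ := Countable.copy move (pcan_type move_codeK).
HB.instance Definition _ : isFinite move := PCanIsFinite move_codeK.

Section TuringMachines.
Variable Sigma : finType.

(* [None] is the blank, [Some (inl _)] an input letter and [Some (inr _)] an
   auxiliary tape symbol. *)
Definition tape_symbol (Gamma : finType) : finType := option (Sigma + Gamma)%type.

(* A machine has [ntm_extra.+1] two-way infinite tapes; tape [ord0] carries the
   input.  The set [ntm_delta q r] lists the actions available in state [q] when
   [r i] is scanned on tape [i]; an action gives the next state and, for each
   tape, the symbol written and the head move. *)
Record ntm := NTM {
  ntm_state : finType;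
  ntm_aux : finType;
  ntm_extra : nat;
  ntm_start : ntm_state;
  ntm_accept : pred ntm_state;
  ntm_delta :
    ntm_state -> {ffun 'I_ntm_extra.+1 -> tape_symbol ntm_aux} ->
    {set ntm_state * {ffun 'I_ntm_extra.+1 -> tape_symbol ntm_aux * move}}
}.

(* [tape_left] is listed from the head outwards; cells beyond either list are
   blank. *)
Record tape (Gamma : finType) := Tape {
  tape_left : seq (tape_symbol Gamma);
  tape_head : tape_symbol Gamma;
  tape_right : seq (tape_symbol Gamma)
}.

Definition tape_act (Gamma : finType)
    (t : tape Gamma) (a : tape_symbol Gamma * move) : tape Gamma :=
  let: Tape l _ r := t in
  let: (s, d) := a in
  match d with
  | MoveL => Tape (behead l) (head None l) (s :: r)
  | MoveR => Tape (s :: l) (head None r) (behead r)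
  | Stay => Tape l s r
  end.

Variable M : ntm.

Record config := Config {
  cfg_state : ntm_state M;
  cfg_tapes : {ffun 'I_(ntm_extra M).+1 -> tape (ntm_aux M)}
}.

Definition scanned (c : config) :
    {ffun 'I_(ntm_extra M).+1 -> tape_symbol (ntm_aux M)} :=
  [ffun i => tape_head (cfg_tapes c i)].

Definition available (c : config) := ntm_delta (cfg_state c) (scanned c).

Definition step (c c' : config) : Prop :=
  exists2 a, a \in available c &
    c' = Config a.1 [ffun i => tape_act (cfg_tapes c i) (a.2 i)].

Fixpoint steps (n : nat) (c c' : config) : Prop :=
  if n is m.+1 then exists2 c1, step c c1 & steps m c1 c' else c = c'.

Definition input_tape (w : seq Sigma) : tape (ntm_aux M) :=
  let s := [seq Some (inl x) | x <- w] in
  Tape [::] (head None s) (behead s).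

Definition start_config (w : seq Sigma) : config :=
  Config (ntm_start M)
    [ffun i => if i == ord0 then input_tape w else Tape [::] None [::]].

Definition accepts (w : seq Sigma) : Prop :=
  exists n c, [/\ steps n (start_config w) c, available c = finset.set0
                & ntm_accept (cfg_state c)].

(* The bound applies to all computation paths, accepting or not. *)
Definition runs_in_time (f : nat -> nat) : Prop :=
  forall w n c, steps n (start_config w) c -> n <= f (size w).

End TuringMachines.

Definition NP (Sigma : finType) (L : set (seq Sigma)) : Prop :=
  exists M : ntm Sigma,
    (exists c d : nat, runs_in_time M (fun n => c * n ^ d + c)) /\
    (forall w, L w <-> accepts M w).

(** * ALCO *)

Unset Implicit Arguments.

(* Names are words over a binary alphabet; the three sorts of names are kept
   apart by the syntax of concepts and assertions. *)
Definition cname := seq bool.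
Definition rname := seq bool.
Definition iname := seq bool.

Inductive concept :=
| Atom of cname
| Nominal of iname
| Top
| Bot
| And of concept & concept
| Or of concept & concept
| Not of concept
| Exists of rname & concept
| Forall of rname & concept.

Variant inclusion := Sub of concept & concept.

Variant assertion :=
| CAssert of cname & iname
| RAssert of rname & iname & iname.

HB.instance Definition _ := gen_eqMixin concept.
HB.instance Definition _ := gen_eqMixin inclusion.
HB.instance Definition _ := gen_eqMixin assertion.

Fixpoint concept_inds (C : concept) : seq iname :=
  match C with
  | Nominal a => [:: a]
  | Atom _ | Top | Bot => [::]
  | And C D | Or C D => concept_inds C ++ concept_inds D
  | Not C | Exists _ C | Forall _ C => concept_inds C
  end.

Definition inclusion_inds (tau : inclusion) : seq iname :=
  let: Sub B C := tau in concept_inds B ++ concept_inds C.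

Definition assertion_inds (alpha : assertion) : seq iname :=
  match alpha with
  | CAssert _ a => [:: a]
  | RAssert _ a b => [:: a; b]
  end.

(* The domain is a set of individual names and of further, anonymous elements,
   so that an individual name [a] can be interpreted as [a] itself. *)
Record interp := Interp {
  anon : Type;
  dom : set (iname + anon);
  cint : cname -> set (iname + anon);
  rint : rname -> set ((iname + anon) * (iname + anon));
  dom_nonempty : dom !=set0;
  cint_dom : forall A, cint A `<=` dom;
  rint_dom : forall R, rint R `<=` dom `*` dom
}.

Fixpoint ext (I : interp) (C : concept) : set (iname + anon I) :=
  match C with
  | Atom A => cint I A
  | Nominal a => [set inl a]
  | Top => dom I
  | Bot => set0
  | And C D => ext I C `&` ext I D
  | Or C D => ext I C `|` ext I D
  | Not C => dom I `\` ext I C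
  | Exists R C => [set x | dom I x /\ exists y, rint I R (x, y) /\ ext I C y]
  | Forall R C => [set x | dom I x /\ forall y, rint I R (x, y) -> ext I C y]
  end.

Definition sat_assertion (I : interp) (alpha : assertion) : Prop :=
  match alpha with
  | CAssert A a => cint I A (inl a)
  | RAssert R a b => rint I R (inl a, inl b)
  end.

(** * Weighted knowledge bases *)

(* Positive integers, or infinity for [None]. *)
Definition weight := option positive.

Definition weight_val (w : weight) : \bar int :=
  if w is Some p then ((nat_of_pos p)%:Z)%:E else +oo%E.

(* Only the values of the weight functions on the elements of the (finite) TBox
   and ABox are relevant. *)
Record wtbox := WTBox {
  tbox : seq inclusion;
  tweight : inclusion -> weight;
  tbox_uniq : uniq tbox
}.

Record wabox := WABox {
  abox : seq assertion;
  aweight : assertion -> weight;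
  abox_uniq : uniq abox
}.

Record wkb := WKB { wkb_tbox : wtbox; wkb_abox : wabox }.

Definition wkb_inds (K : wkb) : seq iname :=
  flatten [seq inclusion_inds tau | tau <- tbox (wkb_tbox K)] ++
  flatten [seq assertion_inds alpha | alpha <- abox (wkb_abox K)].

(* The standard names assumption for the individual names of the input; together
   with the clause for nominals in [ext] and with [sat_assertion] it says that
   [a] denotes [a]. *)
Definition interp_of (K : wkb) (I : interp) : Prop :=
  forall a, a \in wkb_inds K -> dom I (inl a).

Definition ecard {T : Type} (X : set T) : \bar int :=
  match pselect (finite_set X) with
  | left fX => ((projT1 (cid fX))%:Z)%:E
  | right _ => +oo%E
  end.

Definition vio_incl (I : interp) (tau : inclusion) : set (iname + anon I) :=
  let: Sub B C := tau in ext I (And B (Not C)).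

Definition vio_abox (I : interp) (A : seq assertion) : seq assertion :=
  [seq alpha <- A | `[< ~ sat_assertion I alpha >]].

(* In [\bar int], 0 * +oo = 0. *)
Definition cost (K : wkb) (I : interp) : \bar int :=
  let T := wkb_tbox K in
  let A := wkb_abox K in
  (\sum_(tau <- tbox T) weight_val (tweight T tau) * ecard (vio_incl I tau) +
   \sum_(alpha <- vio_abox I (abox A)) weight_val (aweight A alpha))%E.

Definition BCS (K : wkb) (k : int) : Prop :=
  exists I : interp, interp_of K I /\ (cost K I <= k%:E)%E.

(** * String encoding of weighted ABoxes *)

Variant letter :=
  Zero | One | Infty | ConceptMark | RoleMark | Comma | Semicolon.

Definition letter_code (x : letter) : 'I_7 :=
  inord (match x with
         | Zero => 0 | One => 1 | Infty => 2 | ConceptMark => 3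
         | RoleMark => 4 | Comma => 5 | Semicolon => 6
         end).
Definition letter_decode (i : 'I_7) : option letter :=
  onth [:: Zero; One; Infty; ConceptMark; RoleMark; Comma; Semicolon] i.
Lemma letter_codeK : pcancel letter_code letter_decode.
Proof. by case; rewrite /letter_decode /letter_code inordK. Qed.
HB.instance Definition _ := Countable.copy letter (pcan_type letter_codeK).
HB.instance Definition _ : isFinite letter := PCanIsFinite letter_codeK.

Definition enc_name (s : seq bool) : seq letter :=
  [seq if b then One else Zero | b <- s].

(* Binary notation, most significant digit first. *)
Fixpoint enc_pos (p : positive) : seq letter :=
  match p with
  | xH => [:: One]
  | xO q => rcons (enc_pos q) Zero
  | xI q => rcons (enc_pos q) One
  end.

Definition enc_weight (w : weight) : seq letter :=
  if w is Some p then enc_pos p else [:: Infty].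

Definition enc_assertion (alpha : assertion) : seq letter :=
  match alpha with
  | CAssert A a => ConceptMark :: enc_name A ++ Comma :: enc_name a
  | RAssert R a b =>
      RoleMark :: enc_name R ++ Comma :: enc_name a ++ Comma :: enc_name b
  end.

Definition enc_wabox (A : wabox) : seq letter :=
  flatten [seq enc_assertion alpha ++ Comma ::
               rcons (enc_weight (aweight A alpha)) Semicolon
          | alpha <- abox A].

(* The language whose complexity is the data complexity of BCS: the weighted
   TBox and the bound are parameters, the weighted ABox is the input. *)
Definition BCS_data (T : wtbox) (k : int) : set (seq letter) :=
  [set w | exists A : wabox, w = enc_wabox A /\ BCS (WKB T A) k].

(* Main.v *)
(** Only the at most [k] elements violating inclusions and the individuals of
    the ABox matter.  An interpretation of cost at most [k] is filtrated to a
    pattern whose size depends only on the TBox and [k]; conversely a map from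
    the individuals to a pattern that is injective on violators unfolds to an
    interpretation which is no more expensive.  So one guesses a label for every
    occurrence of an individual in the input.  Since [k] is fixed, a finite
    automaton checks syntax, admissibility of the labels and the capped cost.
    It remains to compare pairs of occurrences: equal names must carry equal
    labels, equal violator labels must belong to equal names, and no assertion
    may occur twice.  A pair of positions at distance [d] is seen by a finite
    automaton reading the labelled word [u] in parallel with its shift
    [drop d u], so it suffices that a Turing machine runs automata on all the
    shifts of a guessed word. *)

From HB Require Import structures.
Require Import Defs.
From mathcomp Require Import zify.

Set Implicit Arguments.
Unset Strict Implicit.
Unset Printing Implicit Defensive.

(** * Shifted comparisons on a Turing machine *)

(** Two obstacles shape the proof. Unfolding copies an element of the pattern for every individual
    carrying its label. Copies of a non-violator are free and a nominal is its own only copy, but a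
    second copy of a violator would be paid for again; this is why a slot may serve one name only.
    Moreover, the names of the ABox are arbitrarily long, while an automaton keeps only a prefix of
    each. A prefix beyond the longest name of the TBox settles every comparison with the TBox, and
    predicates that long are given full extensions, so that assertions on them hold whatever the
    name is. What remains is to compare names of the input with each other, which no finite memory
    can do; running through all shifts takes quadratic time. The machine never writes down a
    pattern. Which sets of truncated labelled assertions some pattern can serve depends on the TBox
    and [k] alone, so the answers form a finite table inside the automaton, and the mere existence
    of this table suffices. *)

Lemma ranked_machine (Sigma : finType) (M : ntm Sigma) (A : Type)
    (rel : config M -> A -> Prop) (rank : A -> nat) (good : A -> Prop)
    (start : seq Sigma -> A) :
  (forall w, rel (start_config M w) (start w)) ->
  (forall c a c', rel c a -> step c c' ->
     exists a', [/\ rel c' a', rank a' < rank a & good a' -> good a]) ->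
  (forall c a, rel c a -> good a ->
     (available c = finset.set0 /\ ntm_accept (cfg_state c)) \/
     exists c' a', [/\ step c c', rel c' a', rank a' < rank a & good a']) ->
  (forall c a, rel c a -> available c = finset.set0 ->
     ntm_accept (cfg_state c) -> good a) ->
  (forall w n c, steps n (start_config M w) c -> n <= rank (start w)) /\
  (forall w, accepts M w <-> good (start w)).
Proof.
move=> rel0 fwd prog acc.
(* One induction on runs gives both the time bound and the transfer of [good] back from the last
   stage to the first. *)
have bound n : forall c a c', rel c a -> steps n c c' ->
    n <= rank a /\ exists a', rel c' a' /\ (good a' -> good a).
  elim: n => [|n IH] c a c' rca /= => [<-|[c1 st sts]].
    by split=> //; exists a.
  have [a1 [r1 lt1 g1]] := fwd _ _ _ rca st.
  have [le1 [a' [r' g']]] := IH _ _ _ r1 sts.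
  by split; [apply: leq_ltn_trans lt1|exists a'; split=> // /g'/g1].
split=> [w n c /(bound _ _ _ _ (rel0 w))[]//|w]; split.
  case=> n [c [sts av ac]].
  have [_ [a' [r' g']]] := bound _ _ _ _ (rel0 w) sts.
  by apply: g'; apply: acc r' av ac.
move=> gw.
suff: forall m c a, rank a < m -> rel c a -> good a -> exists n c',
    [/\ steps n c c', available c' = finset.set0 & ntm_accept (cfg_state c')].
  by move=> /(_ _ _ _ (ltnSn _) (rel0 w) gw).
elim=> // m IH c a rk rca ga.
case: (prog _ _ rca ga) => [[av ac]|[c' [a' [st rca' lt' ga']]]].
  by exists 0, c.
have [n [c2 [sts av ac]]] := IH c' a' (leq_trans lt' rk) rca' ga'.
by exists n.+1, c2; split=> //; exists c'.
Qed.

Section Tapes.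
Variables (Sigma Gamma : finType).
Local Notation sym := (tape_symbol Sigma Gamma).

(* Two lists of cells describe the same half-tape when they agree up to
   trailing blanks. *)
Definition eqcells (s s' : seq sym) := nth None s =1 nth None s'.

(* The head scans the first cell of [r]; [l] is listed from the head outwards. *)
Definition tape_is (t : tape Sigma Gamma) (l r : seq sym) :=
  eqcells (tape_left t) l /\ eqcells (tape_head t :: tape_right t) r.

Lemma tape_is_head t l r : tape_is t l r -> tape_head t = head None r.
Proof. by case=> _ /(_ 0); case: r. Qed.

Lemma eqcells_behead s s' : eqcells s s' -> eqcells (behead s) (behead s').
Proof. by move=> e i; rewrite !nth_behead. Qed.

Lemma eqcells_headbehead s s' :
  eqcells s s' -> eqcells (head None s :: behead s) s'.
Proof. by move=> e [|i] /=; rewrite -e ?nth_behead // nth0. Qed.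

Lemma eqcells_cons x s s' : eqcells s s' -> eqcells (x :: s) (x :: s').
Proof. by move=> e [|i] /=. Qed.

Lemma tape_actR t l r s :
  tape_is t l r -> tape_is (tape_act t (s, MoveR)) (s :: l) (behead r).
Proof.
case: t => l0 h r0 [/= el er]; split=> /=; first exact: eqcells_cons.
by apply: eqcells_headbehead; have /= := eqcells_behead er.
Qed.

Lemma tape_actL t l r s : tape_is t l r ->
  tape_is (tape_act t (s, MoveL)) (behead l) (head None l :: s :: behead r).
Proof.
case: t => l0 h r0 [/= el er]; split=> /=; first exact: eqcells_behead.
have -> : head None l0 = head None l by rewrite -!nth0.
by do 2!apply: eqcells_cons; have := eqcells_behead er.
Qed.

Lemma tape_actS t l r s :
  tape_is t l r -> tape_is (tape_act t (s, Stay)) l (s :: behead r).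
Proof.
case: t => l0 h r0 [/= el er]; split=> //=.
by apply: eqcells_cons; have := eqcells_behead er.
Qed.

Lemma tape_is_eq t l r l' r' :
  tape_is t l r -> eqcells l l' -> eqcells r r' -> tape_is t l' r'.
Proof. by move=> [e1 e2] e3 e4; split=> i; rewrite (e1,e2) (e3,e4). Qed.

Lemma eqcells_blank : eqcells [:: None] [::].
Proof. by case=> // -[]. Qed.

End Tapes.

(** * A machine scanning a guessed word against its own shifts *)

Section ShiftMachine.
Variables (Sigma X Q : finType).
Local Notation A := (Sigma * X)%type.
Variables (init0 init1 : Q) (delta : Q -> A * A -> Q) (ok : pred Q).

Local Notation sym := (tape_symbol Sigma A).
Local Notation stq := (Q + 'I_5)%type.

Local Notation q_copy := (inr (inord 0) : stq).
Local Notation q_rew b := (inr (inord (if b then 1 else 2)) : stq).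
Local Notation q_drop := (inr (inord 3) : stq).
Local Notation q_acc := (inr (inord 4) : stq).

Definition shift_action (a0 a1 a2 : sym * move) : {ffun 'I_3 -> sym * move} :=
  [ffun i => nth a2 [:: a0; a1; a2] (i : 'I_3)].

(** While tape 0 is consumed, the guessed word is written on tapes 1 and 2. The first scan, from
    [init0], reads the word against itself. Each drop then erases one cell of tape 1 only, so that
    the next scan, from [init1], reads the next shift; the blank left behind stops the next
    rewind. *)
Definition shift_delta (q : stq) (r : {ffun 'I_3 -> sym}) :
    {set stq * {ffun 'I_3 -> sym * move}} :=
  let r1 := r (inord 1) in
  let r2 := r (inord 2) in
  let stay0 := (None, Stay) in
  match q with
  | inl p =>
    match r1, r2 with
    | Some (inr a), Some (inr b) =>
        [set (inl (delta p (a, b)), shift_action stay0 (r1, MoveR) (r2, MoveR))]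
    | None, _ => if ok p then
          [set (q_rew false, shift_action stay0 (r1, MoveL) (r2, MoveL))]
        else finset.set0
    | _, _ => finset.set0
    end
  | inr i =>
    match val i with
    | 0 => match r ord0 with
           | Some (inl s) =>
               [set (q_copy, shift_action (None, MoveR)
                  (Some (inr (s, x)), MoveR) (Some (inr (s, x)), MoveR)) | x : X]
           | _ => [set (q_rew true, shift_action stay0 (None, MoveL) (None, MoveL))]
           end
    | 3 => if r1 is None then [set (q_acc, shift_action stay0 stay0 stay0)]
           else [set (inl init1, shift_action stay0 (None, MoveR) (r2, Stay))]
    | 4 => finset.set0
    | n => if r1 is None then
             [set (if n == 1 then inl init0 else q_drop,
                   shift_action stay0 (r1, MoveR) (r2, MoveR))]
           else [set (q_rew (n == 1), shift_action stay0 (r1, MoveL) (r2, MoveL))]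
    end
  end%SET.

Definition shift_machine : ntm Sigma :=
  @NTM Sigma stq A 2 q_copy (fun q => q == q_acc) shift_delta.

(* Stages of a run, with the words on the two working tapes cut at the heads;
   the left parts are reversed. *)
Inductive stage :=
| Copying of seq A & seq Sigma
| Rewinding of bool & seq A & seq A & seq A & seq A
| Scanning of Q & seq A & seq A & seq A & seq A
| Dropping of seq A & seq A
| Accepted.

Definition cells : seq A -> seq sym := map (fun a => Some (inr a)).

(** The two heads move in step between drops, hence [size l1 = size l2]: when one rewind ends, so
    does the other. The bound [size r1 <= size r2] makes tape 1 run out first. During a rewind the
    scanned cell is the head of [l1], or the blank before the word. *)
Definition stage_rel (c : config shift_machine) (s : stage) : Prop :=
  let t i := cfg_tapes c (inord i) in
  match s with
  | Copying l w =>
      [/\ cfg_state c = q_copy,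
          exists l0, tape_is (t 0) l0 [seq Some (inl x) | x <- w],
          tape_is (t 1) (cells l) [::] & tape_is (t 2) (cells l) [::]]
  | Rewinding b l1 r1 l2 r2 =>
      [/\ cfg_state c = q_rew b,
          tape_is (t 1) (cells (behead l1)) (head None (cells l1) :: cells r1),
          tape_is (t 2) (cells (behead l2)) (head None (cells l2) :: cells r2)
          & size l1 = size l2 /\ size r1 <= size r2]
  | Scanning q l1 r1 l2 r2 =>
      [/\ cfg_state c = inl q, tape_is (t 1) (cells l1) (cells r1),
          tape_is (t 2) (cells l2) (cells r2)
          & size l1 = size l2 /\ size r1 <= size r2]
  | Dropping r1 r2 =>
      [/\ cfg_state c = q_drop, tape_is (t 1) [::] (cells r1),
          tape_is (t 2) [::] (cells r2) & size r1 <= size r2]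
  | Accepted => cfg_state c = q_acc
  end.

Fixpoint shifts_ok (u v : seq A) : bool :=
  if u is _ :: u' then ok (foldl delta init1 (zip u' v)) && shifts_ok u' v
  else true.

Definition stage_good (s : stage) : Prop :=
  match s with
  | Copying l w => exists2 v, map fst v = w &
      let u := catrev l v in
      ok (foldl delta init0 (zip u u)) && shifts_ok u u
  | Rewinding b l1 r1 l2 r2 =>
      let u := catrev l1 r1 in let v := catrev l2 r2 in
      (b ==> ok (foldl delta init0 (zip u v))) && shifts_ok u v
  | Scanning q l1 r1 l2 r2 =>
      ok (foldl delta q (zip r1 r2)) && shifts_ok (catrev l1 r1) (catrev l2 r2)
  | Dropping u v => shifts_ok u v
  | Accepted => True
  end.

(** With [n] cells left on tape 1, a round erases one, scans the others and rewinds over them; the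
    increment [drop_rank n - drop_rank (n - 1) = 2 * n + 3] pays for this, and the final [1] for
    acceptance. *)
Definition drop_rank n := n ^ 2 + 4 * n + 1.

Definition stage_rank (s : stage) : nat :=
  match s with
  | Copying l w => let n := size l + size w in
      size w + n + 2 * n + 5 + drop_rank n
  | Rewinding b l1 r1 _ _ => let n := size l1 + size r1 in
      size l1 + 1 + (if b then 2 * n + 2 else 0) + drop_rank n
  | Scanning _ l1 r1 _ _ => let n := size l1 + size r1 in
      size r1 + n + 2 + drop_rank n
  | Dropping u _ => drop_rank (size u)
  | Accepted => 0
  end.

Definition shift_next (c : config shift_machine) (q : stq) a0 a1 a2 :=
  @Config _ shift_machine q
    [ffun i => tape_act (cfg_tapes c i) (shift_action a0 a1 a2 i)].

Lemma shift_nextE c q a0 a1 a2 :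
  [/\ cfg_tapes (shift_next c q a0 a1 a2) (inord 0) =
        tape_act (cfg_tapes c (inord 0)) a0,
      cfg_tapes (shift_next c q a0 a1 a2) (inord 1) =
        tape_act (cfg_tapes c (inord 1)) a1 &
      cfg_tapes (shift_next c q a0 a1 a2) (inord 2) =
        tape_act (cfg_tapes c (inord 2)) a2].
Proof. by rewrite /= !ffunE !inordK. Qed.

Definition single_next (c : config shift_machine) s (q : stq) a0 a1 a2 s' :=
  [/\ available c = [set (q, shift_action a0 a1 a2)]%SET,
      stage_rel (shift_next c q a0 a1 a2) s',
      stage_rank s' < stage_rank s & (stage_good s' <-> stage_good s)].

(* Outside the copying stage the machine is deterministic. *)
Lemma stage_step c s : stage_rel c s ->
  match s with
  | Copying l w =>
      if w is x :: w' then
        available c = [set (q_copy, shift_action (None, MoveR)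
           (Some (inr (x, y)), MoveR) (Some (inr (x, y)), MoveR)) | y : X]%SET /\
        forall y, stage_rel (shift_next c q_copy (None, MoveR)
           (Some (inr (x, y)), MoveR) (Some (inr (x, y)), MoveR))
           (Copying ((x, y) :: l) w')
      else exists q a0 a1 a2 s', single_next c s q a0 a1 a2 s'
  | Scanning q l1 [::] l2 r2 =>
      if ok q then exists q a0 a1 a2 s', single_next c s q a0 a1 a2 s'
      else available c = finset.set0
  | Accepted => available c = finset.set0
  | _ => exists q a0 a1 a2 s', single_next c s q a0 a1 a2 s'
  end.
Proof.
have e0 : ord0 = inord 0 :> 'I_3 by apply: val_inj; rewrite /= inordK.
(* The action set is named so that it is computed once, in [av], rather than in each of its copies
   in the goal. *)
have [D eD av] : exists2 D, available c = D &
  D = shift_delta (cfg_state c) (scanned c) by exists (available c).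
rewrite /single_next eD {eD}.
case: s => [l w|b l1 r1 l2 r2|q l1 r1 l2 r2|u v|].
- case=> cs [l0 t0] t1 t2; move: av.
  rewrite cs /shift_delta /= !inordK // !ffunE e0 (tape_is_head t0).
  case: w t0 => [|x w] t0 /= av.
    exists (q_rew true), (None, Stay), (None, MoveL), (None, MoveL).
    exists (Rewinding true l [::] l [::]); split=> //.
    + have [_ e1 e2] := shift_nextE c (q_rew true) (None, Stay) (None, MoveL) (None, MoveL).
      rewrite /stage_rel e1 e2; split=> //.
        apply: tape_is_eq (tape_actL None t1) _ _; first by rewrite /cells behead_map.
        exact/eqcells_cons/eqcells_blank.
      apply: tape_is_eq (tape_actL None t2) _ _; first by rewrite /cells behead_map.
      exact/eqcells_cons/eqcells_blank.
    + rewrite /= /drop_rank; lia.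
    + split=> /=; first by move=> h; exists [::].
      by case=> -[].
  split=> // y.
  have [e0' e1 e2] := shift_nextE c q_copy (None, MoveR)
    (Some (inr (x, y)), MoveR) (Some (inr (x, y)), MoveR).
  rewrite /stage_rel e0' e1 e2; split=> //.
  + by exists (None :: l0); have := tape_actR None t0.
  + by have := tape_actR (Some (inr (x, y))) t1.
  + by have := tape_actR (Some (inr (x, y))) t2.
- case=> cs t1 t2 [sl sr]; move: av.
  rewrite cs /shift_delta /= !ffunE (tape_is_head t1) (tape_is_head t2) /=.
  case: l1 l2 sl t1 t2 => [|a1 l1] [|a2 l2] //= sl t1 t2 av.
    exists (if b then inl init0 else q_drop), (None, Stay), (None, MoveR), (None, MoveR).
    exists (if b then Scanning init0 [::] r1 [::] r2 else Dropping r1 r2).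
    split.
    + by rewrite av; case: b {cs av}; rewrite inordK.
    + have [_ e1 e2] := shift_nextE c (if b then inl init0 else q_drop) (None, Stay) (None, MoveR) (None, MoveR).
      (* The blank just passed is a trailing cell, so the left half-tape is again empty up to
         [eqcells]. *)
      have t1' := tape_is_eq (tape_actR None t1) (@eqcells_blank _ _) (fun=> erefl).
      have t2' := tape_is_eq (tape_actR None t2) (@eqcells_blank _ _) (fun=> erefl).
      by case: b e1 e2 {cs av} => e1 e2; rewrite /stage_rel e1 e2.
    + case: b {cs av} ; rewrite /= ?add0n ?addn0; lia.
    + by case: b {cs av}.
  exists (q_rew b), (None, Stay), (Some (inr a1), MoveL), (Some (inr a2), MoveL).
  exists (Rewinding b l1 (a1 :: r1) l2 (a2 :: r2)); split=> //.
  + by rewrite av; case: b {cs av}; rewrite inordK.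
  + have [_ e1 e2] := shift_nextE c (q_rew b) (None, Stay) (Some (inr a1), MoveL) (Some (inr a2), MoveL).
    rewrite /stage_rel e1 e2; split=> //; last by case: sl.
      by have := tape_actL (Some (inr a1)) t1; rewrite /cells behead_map.
    by have := tape_actL (Some (inr a2)) t2; rewrite /cells behead_map.
  + by case: b {cs av}; rewrite /stage_rank ![size (_ :: _)]/= -(addSnnS (size l1) (size r1)); lia.
- case=> cs t1 t2 [sl sr]; move: av.
  rewrite cs /shift_delta /= !ffunE (tape_is_head t1) (tape_is_head t2) /=.
  case: r1 sr t1 => [|a1 r1] sr t1 /= av.
    case: ifP av => // okq av.
    exists (q_rew false), (None, Stay), (None, MoveL), (head None (cells r2), MoveL).
    exists (Rewinding false l1 [::] l2 r2); split=> //.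
    + have [_ e1 e2] := shift_nextE c (q_rew false) (None, Stay) (None, MoveL) (head None (cells r2), MoveL).
      rewrite /stage_rel e1 e2; split=> //.
        apply: tape_is_eq (tape_actL None t1) _ _; first by rewrite /cells behead_map.
        exact/eqcells_cons/eqcells_blank.
      apply: tape_is_eq (tape_actL _ t2) _ _; first by rewrite /cells behead_map.
      by apply: eqcells_cons; apply: eqcells_headbehead.
    + rewrite /= /drop_rank; lia.
    + by case: (r2); rewrite /= okq.
  case: r2 sr t2 av => [|a2 r2] //= sr t2 av.
  exists (inl (delta q (a1, a2))), (None, Stay), (Some (inr a1), MoveR), (Some (inr a2), MoveR).
  exists (Scanning (delta q (a1, a2)) (a1 :: l1) r1 (a2 :: l2) r2); split=> //.
  + have [_ e1 e2] := shift_nextE c (inl (delta q (a1, a2))) (None, Stay) (Some (inr a1), MoveR) (Some (inr a2), MoveR).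
    rewrite /stage_rel e1 e2; split=> //; last by rewrite /= sl.
      by have := tape_actR (Some (inr a1)) t1.
    by have := tape_actR (Some (inr a2)) t2.
  + rewrite /stage_rank ![size (_ :: _)]/= -(addSnnS (size l1) (size r1)); lia.
- case=> cs t1 t2 sr; move: av.
  rewrite cs /shift_delta /= !inordK // !ffunE (tape_is_head t1) (tape_is_head t2) /=.
  case: u sr t1 => [|a1 u] sr t1 /= av.
    by exists q_acc, (None, Stay), (None, Stay), (None, Stay), Accepted; split.
  exists (inl init1), (None, Stay), (None, MoveR), (head None (cells v), Stay).
  exists (Scanning init1 [::] u [::] v); split=> //.
  + have [_ e1 e2] := shift_nextE c (inl init1) (None, Stay) (None, MoveR) (head None (cells v), Stay).
    rewrite /stage_rel e1 e2; split=> //.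
    * exact: tape_is_eq (tape_actR None t1) (@eqcells_blank _ _) (fun=> erefl).
    * by apply: tape_is_eq (tape_actS _ t2) _ _ => //; apply: eqcells_headbehead.
    * by split=> //; apply: ltnW.
  + rewrite /= /drop_rank; lia.
by move=> /= cs; rewrite av cs /shift_delta /= inordK.
Qed.

Lemma single_nextP c s q a0 a1 a2 s' : single_next c s q a0 a1 a2 s' ->
  (forall c', step c c' ->
     exists a', [/\ stage_rel c' a', stage_rank a' < stage_rank s
                  & stage_good a' -> stage_good s]) /\
  (stage_good s -> exists c' a', [/\ step c c', stage_rel c' a',
                    stage_rank a' < stage_rank s & stage_good a']) /\
  available c <> finset.set0.
Proof.
case=> av rel lt gd; split; last split.
- move=> c' [a]; rewrite av inE => /eqP -> ->.
  by exists s'; split=> // /gd.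
- move=> /gd g'; exists (shift_next c q a0 a1 a2), s'; split=> //.
  by exists (q, shift_action a0 a1 a2) => //; rewrite av set11.
- by rewrite av => /setP /(_ (q, shift_action a0 a1 a2)); rewrite !inE eqxx.
Qed.

Lemma start_stage w : stage_rel (start_config shift_machine w) (Copying [::] w).
Proof.
split=> //=; rewrite !ffunE -!val_eqE /= !inordK //=.
by exists [::]; split=> //=; apply: eqcells_headbehead.
all: by split=> //; apply: eqcells_blank.
Qed.

Lemma shifts_okP u v : reflect (forall d, 0 < d <= size u ->
  ok (foldl delta init1 (zip (drop d u) v))) (shifts_ok u v).
Proof.
apply: (iffP idP); elim: u => [|a u IH] //=; first by move=> _ [].
  by case/andP=> h /IH hu [|[|d]] lt //; [rewrite /= drop0|apply: (hu d.+1)].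
move=> h; rewrite -{1}(drop0 u) (h 1) //=; apply: IH => d /andP[d0 du].
exact: (h d.+1).
Qed.

Lemma shift_machine_NP : NP [set w | exists u : seq A,
  [/\ map fst u = w, ok (foldl delta init0 (zip u u)) &
      forall d, 0 < d <= size u -> ok (foldl delta init1 (zip (drop d u) u))]]%classic.
Proof.
exists shift_machine.
have [|||| time lang] := @ranked_machine _ shift_machine stage stage_rel
  stage_rank stage_good (Copying [::]).
- exact: start_stage.
- move=> c s c' rel; have := stage_step rel.
  case: s rel => [l [|x w]|b l1 r1 l2 r2|q l1 [|a r1] l2 r2|u v|] rel.
  + by move=> [q [a0 [a1 [a2 [s' /single_nextP[h _]]]]]] /h.
  + case=> av rel' [a]; rewrite av => /imsetP[y _ ->] ->.
    exists (Copying ((x, y) :: l) w); split; first exact: rel'.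
      by rewrite /stage_rank ![size (_ :: _)]/= -(addSnnS (size l) (size w)); lia.
    by move=> [v <- /= h]; exists ((x, y) :: v).
  + by move=> [q [a0 [a1 [a2 [s' /single_nextP[h _]]]]]] /h.
  + case: ifP => _; first by move=> [q' [a0 [a1 [a2 [s' /single_nextP[h _]]]]]] /h.
    by move=> av [a]; rewrite av inE.
  + by move=> [q' [a0 [a1 [a2 [s' /single_nextP[h _]]]]]] /h.
  + by move=> [q [a0 [a1 [a2 [s' /single_nextP[h _]]]]]] /h.
  + by move=> av [a]; rewrite av inE.
- move=> c s rel; have := stage_step rel.
  case: s rel => [l [|x w]|b l1 r1 l2 r2|q l1 [|a r1] l2 r2|u v|] rel.
  + by move=> [q [a0 [a1 [a2 [s' /single_nextP[_ [h _]]]]]]] /h; right.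
  + case=> av rel' [[|[x' y] v] //= [ex ew] h]; right; subst x' w.
    exists (shift_next c q_copy (None, MoveR)
      (Some (inr (x, y)), MoveR) (Some (inr (x, y)), MoveR)).
    exists (Copying ((x, y) :: l) (map fst v)); split.
    * by eexists; first by rewrite av; apply/imsetP; exists y.
    * exact: rel'.
    * by rewrite /stage_rank ![size (_ :: _)]/= size_map -(addSnnS (size l) (size v)); lia.
    * by exists v.
  + by move=> [q [a0 [a1 [a2 [s' /single_nextP[_ [h _]]]]]]] /h; right.
  + case: ifP => okq; first by move=> [q' [a0 [a1 [a2 [s' /single_nextP[_ [h _]]]]]]] /h; right.
    by case: (r2) => [|? ?]; rewrite /= okq.
  + by move=> [q' [a0 [a1 [a2 [s' /single_nextP[_ [h _]]]]]]] /h; right.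
  + by move=> [q [a0 [a1 [a2 [s' /single_nextP[_ [h _]]]]]]] /h; right.
  + by move=> av _; left; split=> //; apply/eqP.
- move=> c s rel av acc; have := stage_step rel.
  case: s rel => [l [|x w]|b l1 r1 l2 r2|q l1 [|a r1] l2 r2|u v|] // rel.
  + by move=> [q [a0 [a1 [a2 [s' /single_nextP[_ [_]]]]]]]; rewrite av.
  + case=> _ _; case: rel => cs *; move: acc; rewrite /= cs.
    by rewrite (inj_eq (@inr_inj _ _)) -val_eqE /= !inordK.
  + by move=> [q [a0 [a1 [a2 [s' /single_nextP[_ [_]]]]]]]; rewrite av.
  + case: ifP => okq; first by move=> [q' [a0 [a1 [a2 [s' /single_nextP[_ [_]]]]]]]; rewrite av.
    by case: rel acc => /= ->.
  + by move=> [q' [a0 [a1 [a2 [s' /single_nextP[_ [_]]]]]]]; rewrite av.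
  + by move=> [q [a0 [a1 [a2 [s' /single_nextP[_ [_]]]]]]]; rewrite av.
split.
  (* The initial rank on an input of length [n] is [n ^ 2 + 8 * n + 6]. *)
  exists 9, 2 => w n c /time /leq_trans; apply.
  by rewrite /= /drop_rank; nia.
move=> w; split; last first.
  move=> /lang [u e /andP[h /shifts_okP hs]].
  by exists u; split.
case=> u [e h /shifts_okP hs]; apply/lang.
by exists u; rewrite //= h.
Qed.

End ShiftMachine.

(** * Finitely determined functions on words *)

Definition trunc (T : Type) n (s : seq T) : n.-bseq T := insub_bseq n (take n s).

Lemma val_trunc (T : Type) n (s : seq T) : trunc n s = take n s :> seq T.
Proof. by rewrite insubdK // -topredE /= size_take_min geq_minl. Qed.

Lemma trunc_eq (T : Type) n (s s' : seq T) :
  trunc n s = trunc n s' <-> take n s = take n s'.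
Proof. by split=> [e|e]; [rewrite -!val_trunc e|apply: val_inj; rewrite /= !val_trunc]. Qed.

(** A prefix with fewer than [n] letters shows that the word ended there. *)
Lemma trunc_short (T : Type) n (s s' : seq T) :
  size s < n -> trunc n s = trunc n s' -> s = s'.
Proof.
move=> lt /trunc_eq e; have := congr1 size e.
rewrite !size_take_min => es; have ls' : size s' < n by lia.
by move: e; rewrite !take_oversize // ltnW.
Qed.

(* Myhill-Nerode style: [f] factors through a right congruence of finite
   index. *)
Definition regular (A : finType) (T : Type) (f : seq A -> T) : Prop :=
  exists (Q : finType) (phi : seq A -> Q),
    (forall s s' a, phi s = phi s' -> phi (rcons s a) = phi (rcons s' a)) /\
    (forall s s', phi s = phi s' -> f s = f s').

Section Regular.
Variable A : finType.
Implicit Types (s : seq A) (a : A).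

Lemma regular_congr (Q : finType) (phi : seq A -> Q) :
  (forall s s' a, phi s = phi s' -> phi (rcons s a) = phi (rcons s' a)) ->
  regular phi.
Proof. by move=> h; exists Q, phi. Qed.

Lemma regular_comp T U (f : seq A -> T) (h : T -> U) :
  regular f -> regular (fun s => h (f s)).
Proof.
by move=> [Q [phi [c e]]]; exists Q, phi; split=> // s s' /e ->.
Qed.

Lemma regular_ext T (f g : seq A -> T) : f =1 g -> regular f -> regular g.
Proof.
by move=> fg [Q [phi [c e]]]; exists Q, phi; split=> // s s' /e; rewrite !fg.
Qed.

Lemma regular_pair T U (f : seq A -> T) (g : seq A -> U) :
  regular f -> regular g -> regular (fun s => (f s, g s)).
Proof.
move=> [Q [phi [c e]]] [Q' [phi' [c' e']]].
exists (Q * Q')%type, (fun s => (phi s, phi' s)); split.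
  by move=> s s' a [/c-> /c'->].
by move=> s s' [/e -> /e' ->].
Qed.

Lemma regular_all (p : pred A) : regular (all p).
Proof. by apply: regular_congr => s s' a; rewrite !all_rcons => ->. Qed.

Lemma take_rcons_take n s a : take n (rcons (take n s) a) = take n (rcons s a).
Proof.
have [le_sn|lt_ns] := leqP (size s) n; first by rewrite [X in rcons X]take_oversize.
rewrite -!cats1 take_size_cat ?size_take ?lt_ns // takel_cat //; exact: ltnW.
Qed.

Lemma regular_trunc n : regular (trunc n : seq A -> n.-bseq A).
Proof.
apply: regular_congr => s s' a /trunc_eq e; apply/trunc_eq.
by rewrite -take_rcons_take e take_rcons_take.
Qed.

Lemma regular_foldl (Q : finType) (delta : Q -> A -> Q) q0 :
  regular (foldl delta q0).
Proof. by apply: regular_congr => s s' a; rewrite !foldl_rcons => ->. Qed.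

(** The states are the classes, and a letter acts through a chosen representative [word q]; the
    congruence makes the choice harmless. Representatives and final states are obtained classically,
    so [P] need not be decidable. *)
Lemma regular_dfa (P : seq A -> Prop) : regular P ->
  exists (Q : finType) (q0 : Q) (delta : Q -> A -> Q) (ok : pred Q),
    forall s, P s <-> ok (foldl delta q0 s).
Proof.
move=> [Q [phi [c e]]].
pose word q := xget [::] [set s | phi s = q]%classic.
have wordK s : phi (word (phi s)) = phi s.
  exact: (@xgetPex _ [::] [set s' | phi s' = phi s]%classic (ex_intro _ s erefl)).
exists Q, (phi [::]), (fun q a => phi (rcons (word q) a)), (fun q => `[< P (word q) >]).
move=> s; suff -> : foldl (fun q a => phi (rcons (word q) a)) (phi [::]) s = phi s.
  by rewrite -(e _ _ (wordK s)); split=> /asboolP.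
elim/last_ind: s => // s a IH; rewrite foldl_rcons IH.
exact/c/wordK.
Qed.

(* The maximal delimiter-free blocks of a word, each with the delimiter that
   ends it, and the unfinished last block. *)
Definition blocks_from (d : pred A) : seq (seq A * A) * seq A -> seq A ->
    seq (seq A * A) * seq A :=
  foldl (fun p a => if d a then (rcons p.1 (p.2, a), [::])
                    else (p.1, rcons p.2 a)).

Definition blocks d := blocks_from d ([::], [::]).

Definition unblocks (p : seq (seq A * A) * seq A) : seq A :=
  flatten [seq rcons b.1 b.2 | b <- p.1] ++ p.2.

Lemma blocks_rcons d s a : blocks d (rcons s a) =
  let p := blocks d s in
  if d a then (rcons p.1 (p.2, a), [::]) else (p.1, rcons p.2 a).
Proof. by rewrite /blocks /blocks_from foldl_rcons. Qed.

Lemma blocksK d s : unblocks (blocks d s) = s.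
Proof.
elim/last_ind: s => // s a {2}<-; rewrite blocks_rcons /unblocks /=.
case: ifP => _ /=; last by rewrite rcons_cat.
by rewrite map_rcons flatten_rcons cats0 /= -rcons_cat.
Qed.

Lemma blocks_delim d s : all (fun b => d b.2) (blocks d s).1.
Proof.
elim/last_ind: s => // s a IH; rewrite blocks_rcons /=.
by case: ifP => da //=; rewrite all_rcons /= da.
Qed.

Lemma blocks_from_free d p b : all (predC d) b ->
  blocks_from d p b = (p.1, p.2 ++ b).
Proof.
elim: b p => [|a b IH] p fb; first by rewrite cats0; case: p.
case/andP: fb => /= /negPf da fb.
rewrite -/(blocks_from d (if d a then (rcons p.1 (p.2, a), [::])
                          else (p.1, rcons p.2 a)) b).
by rewrite da IH //= cat_rcons.
Qed.

Lemma blocks_from_cat d p b a s : all (predC d) b -> d a ->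
  blocks_from d p (b ++ a :: s) =
  blocks_from d (rcons p.1 (p.2 ++ b, a), [::]) s.
Proof.
move=> fb da.
have -> : blocks_from d p (b ++ a :: s) =
    blocks_from d (blocks_from d p b) (a :: s) by apply: foldl_cat.
by rewrite (blocks_from_free _ fb) /blocks_from /= da.
Qed.

(** A two-level automaton: the inner one reads the current block, and at a delimiter its value, a
    letter of the finite alphabet [K * A], is fed to the outer one. *)
Lemma regular_blocks d (K : finType) (f : seq A -> K) T (F : seq (K * A) -> T) :
  regular f -> regular F ->
  regular (fun s => (F [seq (f b.1, b.2) | b <- (blocks d s).1],
                     f (blocks d s).2)).
Proof.
move=> [Q [phi [c e]]] [Q' [phi' [c' e']]].
exists (Q' * Q)%type,
  (fun s => (phi' [seq (f b.1, b.2) | b <- (blocks d s).1], phi (blocks d s).2)).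
split=> s s'; last by case=> /e' -> /e ->.
move=> a [h h']; rewrite !blocks_rcons /=; case: ifP => _ /=.
  by rewrite !map_rcons /= (e _ _ h') (c' _ _ _ h).
by rewrite h (c _ _ _ h').
Qed.

(* After a letter satisfying [st], the letters satisfying [co] are skipped; the
   first other letter is then compared with the one that started the track. *)
Variables (st co : pred A) (bad : rel A).

Fixpoint follow (x : A) (s : seq A) : bool :=
  if s is a :: s' then if co a then follow x s' else ~~ bad x a else true.

Fixpoint tracked (s : seq A) : bool :=
  if s is a :: s' then (st a ==> follow a s') && tracked s' else true.

Lemma tracked_drop n s : tracked s -> tracked (drop n s).
Proof. by elim: s n => [|a s IH] [|n] //= /andP[_ /IH]. Qed.

Lemma trackedP s : (forall n a s', drop n s = a :: s' -> st a -> follow a s') ->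
  tracked s.
Proof.
elim: s => //= a s IH h; apply/andP; split.
  by apply/implyP; apply: (h 0); rewrite drop0.
by apply: IH => n; apply: (h n.+1).
Qed.

(** A letter that starts a track is never skipped, so it ends any pending track. Hence one register
    for a starting letter is enough; the outer [None] is the dead state. *)
Lemma regular_tracked : (forall a, st a -> ~~ co a) -> regular tracked.
Proof.
move=> disj.
pose next (a : A) := if st a then Some a else None.
pose delta (q : option (option A)) a := match q with
  | None => None
  | Some None => Some (next a)
  | Some (Some x) => if co a then q else if bad x a then None else Some (next a)
  end.
apply: (@regular_ext _ (fun s => foldl delta (Some None) s != None)); last first.
  exact: (regular_comp (fun q => q != None) (regular_foldl delta (Some None))).
have dead s : foldl delta None s = None by elim: s.
suff track q s : (foldl delta (Some q) s != None) =
    (if q is Some x then follow x s else true) && tracked s.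
  by move=> s; rewrite track.
elim: s q => [|a s IH] [x|] //=.
  case: ifP => coa.
    by rewrite IH; case: (boolP (st a)) => // /disj; rewrite coa.
  case: ifP => ba; first by rewrite dead.
  by rewrite IH /next; case: (st a).
by rewrite IH /next; case: (st a).
Qed.

End Regular.

Lemma regular_map (A B : finType) T (g : A -> B) (f : seq B -> T) :
  regular f -> regular (fun s => f (map g s)).
Proof.
move=> [Q [phi [c e]]]; exists Q, (fun s => phi (map g s)); split=> s s'.
  by move=> a h; rewrite !map_rcons; apply: c.
by move=> /e.
Qed.

Theorem shift_NP (Sigma X : finType) (P1 : seq (Sigma * X) -> Prop)
    (P2 : seq ((Sigma * X) * (Sigma * X)) -> Prop) :
  regular P1 -> regular P2 ->
  NP [set w | exists u : seq (Sigma * X), [/\ map fst u = w, P1 u &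
        forall d, 0 < d <= size u -> P2 (zip (drop d u) u)]]%classic.
Proof.
move=> /regular_dfa[Q1 [q1 [d1 [ok1 h1]]]] /regular_dfa[Q2 [q2 [d2 [ok2 h2]]]].
(* The machine has a single automaton, started in [init0] or [init1]; a disjoint union holds both,
   the first reading one component of [zip u u]. *)
pose delta (q : Q1 + Q2) (ab : (Sigma * X) * (Sigma * X)) : Q1 + Q2 :=
  match q with inl q => inl (d1 q ab.1) | inr q => inr (d2 q ab) end.
pose ok (q : Q1 + Q2) := match q with inl q => ok1 q | inr q => ok2 q end.
have [M [time lang]] := shift_machine_NP (inl q1) (inr q2) delta ok.
exists M; split=> // w; rewrite -lang.
have e1 q u : foldl delta (inl q) (zip u u) = inl (foldl d1 q u).
  by elim: u q => //= a u IH q; rewrite IH.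
have e2 q z : foldl delta (inr q) z = inr (foldl d2 q z).
  by elim: z q => //= a z IH q; rewrite IH.
split=> -[u [<- p1 p2]]; exists u; split=> //.
- by rewrite e1; apply/h1.
- by move=> d /p2; rewrite e2 => /h2.
- by apply/h1; move: p1; rewrite e1.
- by move=> d /p2; rewrite e2 => /h2.
Qed.

Import Order.TTheory GRing.Theory Num.Theory.
Local Open Scope classical_set_scope.

(** * Cardinalities and costs *)

Lemma inj_card_le (T U : Type) (X : set T) (Y : set U) (f : T -> U) :
  (forall x, X x -> Y (f x)) ->
  (forall x y, X x -> X y -> f x = f y -> x = y) -> (X #<= Y)%card.
Proof.
move=> XY injf; have fX : {in X &, injective f}.
  by move=> x y; rewrite !in_setE; apply: injf.
rewrite -(card_le_eql (inj_card_eq fX)); apply: subset_card_le => _ [x Xx <-].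
exact: XY.
Qed.

Lemma ecard_le (T U : Type) (X : set T) (Y : set U) :
  (X #<= Y)%card -> (ecard X <= ecard Y)%E.
Proof.
move=> XY; rewrite /ecard; case: (pselect (finite_set Y)) => fY; last by rewrite leey.
have fX := card_le_finite XY fY.
case: pselect => [fX'|//]; rewrite lee_fin; case: cid => n Xn; case: cid => m Ym /=.
by move: XY; rewrite (card_le_eql Xn) (card_le_eqr Ym) card_le_II lez_nat.
Qed.

Lemma ecard_inj (T : Type) (X : set T) k : (ecard X <= (k%:Z)%:E)%E ->
  exists f : T -> 'I_k.+1, forall x y, X x -> X y -> f x = f y -> x = y.
Proof.
rewrite /ecard; case: pselect => // fX; case: cid => n Xn /=; rewrite lee_fin lez_nat => nk.
have /card_set_bijP[f [fX' injf _]] := Xn.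
(* The type ['I_k.+1] is inhabited even for [k = 0], so elements outside [X] get a value too. *)
exists (fun x => inord (f x)) => x y Xx Xy /(congr1 val) /=.
have lt z : X z -> f z < k.+1 by move=> /fX' /= /leq_trans; apply; apply: leqW.
rewrite !inordK ?lt // => e; apply: injf; rewrite ?in_setE //.
Qed.

Lemma weight_val_gt0 w : (0 < weight_val w)%E.
Proof.
case: w => [p|] /=; last by rewrite lt0y.
rewrite lte_fin ltz_nat; elim: p => //= p IH; rewrite ?NatTrec.doubleE; lia.
Qed.

Lemma ecard_ge0 (T : Type) (X : set T) : (0 <= ecard X)%E.
Proof. by rewrite /ecard; case: pselect => [fX|_]; rewrite ?lee_fin ?leey. Qed.

Lemma ecard_le_weight (T : Type) (X : set T) w :
  (ecard X <= weight_val w * ecard X)%E.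
Proof.
rewrite -{1}[ecard X]mul1e; apply: lee_wpmul2r; first exact: ecard_ge0.
by have := weight_val_gt0 w; case: w => [p|] //=; rewrite ?leey // lte_fin lee_fin.
Qed.

Definition tcost (T : wtbox) (I : interp) : \bar int :=
  (\sum_(tau <- tbox T) weight_val (tweight T tau) * ecard (vio_incl I tau))%E.

Lemma tcost_le T I J :
  (forall tau, tau \in tbox T -> (vio_incl I tau #<= vio_incl J tau)%card) ->
  (tcost T I <= tcost T J)%E.
Proof.
move=> le; rewrite /tcost big_seq [leRHS]big_seq; apply: lee_sum => tau /le h.
apply: lee_wpmul2l; [exact/ltW/weight_val_gt0|exact: ecard_le].
Qed.

(** Weights are at least one, so a bound on the cost bounds the number of violators of each
    inclusion; this is what makes finitely many slots enough. *)
Lemma ecard_vio_le T I tau : tau \in tbox T ->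
  (ecard (vio_incl I tau) <= tcost T I)%E.
Proof.
move=> Ttau; apply: (le_trans (ecard_le_weight _ (tweight T tau))).
rewrite /tcost (big_rem tau) //= leeDl // sume_ge0 // => tau' _.
by apply: mule_ge0; [exact/ltW/weight_val_gt0|exact: ecard_ge0].
Qed.

(** * Patterns *)

Fixpoint subconcepts (C : concept) : seq concept :=
  C :: match C with
       | And C D | Or C D => subconcepts C ++ subconcepts D
       | Not C | Exists _ C | Forall _ C => subconcepts C
       | _ => [::]
       end.

Definition tclosure (T : wtbox) : seq concept :=
  flatten [seq let: Sub B C := tau in subconcepts B ++ subconcepts C
          | tau <- tbox T].

Definition tinds (T : wtbox) : seq iname :=
  flatten [seq inclusion_inds tau | tau <- tbox T].

Definition concept_name (C : concept) : seq bool :=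
  match C with
  | Atom s | Nominal s | Exists s _ | Forall s _ => s
  | _ => [::]
  end.

(** A prefix of this length identifies every name of the TBox. The bound is at least 2, so that a
    prefix also identifies the one-letter weight [Infty]. *)
Definition name_bound (T : wtbox) : nat :=
  (\max_(C <- tclosure T) size (concept_name C)).+2.

Lemma name_bound_gt T C : C \in tclosure T -> size (concept_name C) < name_bound T.
Proof. by move=> h; rewrite /name_bound ltnS leqW // (big_rem C) //= leq_maxl. Qed.

Lemma subconcepts_refl C : C \in subconcepts C.
Proof. by case: C => *; rewrite inE eqxx. Qed.

Lemma nominal_subconcepts a C :
  (Nominal a \in subconcepts C) = (a \in concept_inds C).
Proof.
have neq D : (if D is Nominal _ then false else true) -> (Nominal a == D) = false.
  by move=> h; apply/negbTE/eqP => e; rewrite -e in h.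
elim: C => [A|b|||C IHC D IHD|C IHC D IHD|C IHC|R C IHC|R C IHC] /=;
  try by rewrite inE neq // ?mem_cat ?IHC ?IHD.
by rewrite !inE; apply/eqP/eqP => [[]|->].
Qed.

Lemma tclosure_sub T B C : Sub B C \in tbox T ->
  {subset subconcepts B <= tclosure T} /\ {subset subconcepts C <= tclosure T}.
Proof.
by move=> h; split=> D hD; apply/flattenP; exists (subconcepts B ++ subconcepts C);
  rewrite ?mem_cat ?hD ?orbT //; apply/mapP; exists (Sub B C).
Qed.

Lemma nominal_tclosure T a : (Nominal a \in tclosure T) = (a \in tinds T).
Proof.
apply/flattenP/flattenP => -[_ /mapP[[B C] h ->]]; rewrite mem_cat => ha.
  by exists (inclusion_inds (Sub B C)); [apply/mapP; exists (Sub B C)|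
    rewrite mem_cat -!nominal_subconcepts].
by exists (subconcepts B ++ subconcepts C); [apply/mapP; exists (Sub B C)|
  rewrite mem_cat !nominal_subconcepts].
Qed.

(* The label of an individual: a nominal of the TBox, a type (the set of
   concepts of the closure it satisfies), or a slot reserved for one violator
   of one inclusion. *)
Definition label (T : wtbox) (k : nat) : finType :=
  (seq_sub (tinds T) +
   ({ffun 'I_(size (tclosure T)) -> bool} +
    'I_(size (tbox T)) * 'I_k.+1))%type.

Section Patterns.
Variables (T : wtbox) (k : nat).
Local Notation label := (label T k).
Local Notation tinds := (tinds T).

Definition critical (e : label) := if e is inr (inr _) then true else false.

(* A labelled assertion [(s, (a, e), None)] stands for [s(a)] and
   [(s, (a, e), Some (b, e'))] for [s(a, b)], where [e], [e'] label [a], [b]. *)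
Definition lassertion (N : Type) : Type := N * (N * label) * option (N * label).

Definition unlabel (r : lassertion (seq bool)) : assertion :=
  if r.2 is Some be then RAssert r.1.1 r.1.2.1 be.1 else CAssert r.1.1 r.1.2.1.

Definition occs N (r : lassertion N) : seq (N * label) :=
  r.1.2 :: (if r.2 is Some be then [:: be] else [::]).

Lemma assertion_inds_occs r : assertion_inds (unlabel r) = map fst (occs r).
Proof. by case: r => [[s [a e]] [[b e']|]]. Qed.

(** An element with an ordinary label may be copied for any number of individuals, so [pat_ordinary]
    forbids it to violate anything. The embedding is total, but a label is available only if its
    image lies in the domain; this is checked by [fits]. *)
Record pattern := Pattern {
  pat_interp :> interp;
  emb : label -> iname + anon pat_interp;
  emb_inj : injective emb;
  emb_nominal : forall s, emb (inl s) = inl (val s);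
  emb_other : forall y b, emb (inr y) = inl b -> b \notin tinds;
  pat_nominal : forall a, a \in tinds -> dom pat_interp (inl a);
  pat_ordinary : forall t, dom pat_interp (emb (inr (inl t))) ->
    forall tau, tau \in tbox T -> ~ vio_incl pat_interp tau (emb (inr (inl t)))
}.

Definition fits (J : pattern) (ae : iname * label) : Prop :=
  dom J (emb J ae.2) /\
  (if ae.2 is inl s then ae.1 == val s else ae.1 \notin tinds).

Definition lsat (J : pattern) (r : lassertion (seq bool)) : Prop :=
  if r.2 is Some be then rint J r.1.1 (emb J r.1.2.2, emb J be.2)
  else cint J r.1.1 (emb J r.1.2.2).

(** * From a labelling of individuals to an interpretation *)

Section Unfold.
Variables (J : pattern) (os : seq (iname * label)).
Hypothesis os_fits : forall o, o \in os -> fits J o.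
Hypothesis os_fun : forall a e e', (a, e) \in os -> (a, e') \in os -> e = e'.
Hypothesis os_crit : forall a b e, critical e ->
  (a, e) \in os -> (b, e) \in os -> a = b.

Definition unfold_named (a : iname) : Prop := a \in tinds \/ a \in map fst os.

(** The default [inl a] serves the nominals of the TBox that do not occur in [os]. *)
Definition unfold_place (a : iname) : iname + anon J :=
  if [pick e | (a, e) \in os] is Some e then emb J e else inl a.

(* The individuals replace the elements of [J] they are labelled with. *)
Definition unfold_proj (x : iname + (iname + anon J)) : iname + anon J :=
  match x with inl a => unfold_place a | inr y => y end.

(** An element of [J] survives as an anonymous one only if no individual takes its place; otherwise
    a violator could be counted twice. *)
Definition unfold_dom (x : iname + (iname + anon J)) : Prop :=
  match x with
  | inl a => unfold_named a
  | inr y => dom J y /\ forall a, unfold_named a -> unfold_place a <> y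
  end.

Lemma unfold_place_os a e : (a, e) \in os -> unfold_place a = emb J e.
Proof.
move=> h; rewrite /unfold_place; case: pickP => [e' h'|/(_ e)].
  by rewrite (os_fun h h').
by rewrite h.
Qed.

Lemma unfold_place_nominal a : a \in tinds -> unfold_place a = inl a.
Proof.
move=> ha; rewrite /unfold_place; case: pickP => // e h.
case: e h (os_fits h) => [s|y'] h [_ /=]; last by rewrite ha.
by move=> /eqP ->; rewrite emb_nominal.
Qed.

Lemma unfold_place_dom a : unfold_named a -> dom J (unfold_place a).
Proof.
case=> [ha|/mapP[[b e] h ->]] /=; last by rewrite (unfold_place_os h); case: (os_fits h).
by rewrite unfold_place_nominal //; apply: pat_nominal.
Qed.

Lemma unfold_place_eq_nominal a b : unfold_named a -> b \in tinds ->
  unfold_place a = inl b -> a = b.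
Proof.
have [ha _ _|ha] := boolP (a \in tinds).
  by rewrite unfold_place_nominal // => -[].
case=> [|/mapP[[c e] h /= ac]]; first by rewrite (negPf ha).
subst c; rewrite (unfold_place_os h) => hb.
case: e h (os_fits h) => [s|y] h [_ /=]; first by rewrite emb_nominal => /eqP -> [].
by move=> _ /emb_other; rewrite hb.
Qed.

Lemma unfold_dom_proj x : unfold_dom x -> dom J (unfold_proj x).
Proof. by case: x => [a|y] /=; [apply: unfold_place_dom|case]. Qed.

Lemma unfold_surj y : dom J y -> exists2 x, unfold_dom x & unfold_proj x = y.
Proof.
move=> Jy; have [[a na <-]|no] := pselect (exists2 a, unfold_named a & unfold_place a = y).
  by exists (inl a).
by exists (inr y) => //; split=> // a na e; apply: no; exists a.
Qed.

Lemma unfold_nonempty : unfold_dom !=set0.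
Proof. by have [y /unfold_surj[x ux _]] := dom_nonempty J; exists x. Qed.

Lemma unfold_cint_dom A : [set x | unfold_dom x /\ cint J A (unfold_proj x)] `<=`
  unfold_dom.
Proof. by move=> x []. Qed.

Lemma unfold_rint_dom R :
  [set p | [/\ unfold_dom p.1, unfold_dom p.2
             & rint J R (unfold_proj p.1, unfold_proj p.2)]] `<=`
  unfold_dom `*` unfold_dom.
Proof. by move=> [x y] [? ? _]. Qed.

Definition unfolding : interp :=
  @Interp (iname + anon J) unfold_dom _ _ unfold_nonempty
    unfold_cint_dom unfold_rint_dom.

(** The projection is a surjective bisimulation: roles are pulled back from [J], so every edge of
    [J] lifts, and a nominal of the TBox has itself as its only preimage in the domain. *)
Lemma unfolding_ext C : {subset concept_inds C <= tinds} ->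
  forall x, unfold_dom x -> ext unfolding C x <-> ext J C (unfold_proj x).
Proof.
have catP (s s' t : seq iname) : {subset s ++ s' <= t} ->
    {subset s <= t} /\ {subset s' <= t}.
  by move=> h; split=> z hz; apply: h; rewrite mem_cat hz ?orbT.
elim: C => [A|a|||C IHC D IHD|C IHC D IHD|C IHC|R C IHC|R C IHC] /= sub x ux.
- by split=> [[]|].
- have ha : a \in tinds by apply: sub; rewrite inE.
  split=> [->|] /=; first exact: unfold_place_nominal.
  case: x ux => [b|y] /= ux e; first by rewrite (unfold_place_eq_nominal ux ha e).
  by case: ux => _ /(_ a (or_introl ha)); rewrite unfold_place_nominal // e.
- by split=> // _; apply: unfold_dom_proj.
- by [].
- by have [/IHC/(_ _ ux) hC /IHD/(_ _ ux) hD] := catP _ _ _ sub; split=> -[/hC ? /hD].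
- by have [/IHC/(_ _ ux) hC /IHD/(_ _ ux) hD] := catP _ _ _ sub;
    split=> -[/hC|/hD] ?; [left|right|left|right].
- have hC := IHC sub x ux; split=> -[_ n]; split=> //.
  + exact: unfold_dom_proj.
  + by move=> /hC.
  + by move=> /hC.
- split=> -[_ [y [Rxy Cy]]]; split=> //.
  + exact: unfold_dom_proj.
  + by case: Rxy => _ uy Jxy; exists (unfold_proj y); split=> //; apply/IHC.
  + have [_ /= Jy] := rint_dom J R _ Rxy; have [z uz zy] := unfold_surj Jy.
    by exists z; split; [split=> //=; rewrite zy|apply/IHC => //; rewrite zy].
- split=> -[_ h]; split=> //.
  + exact: unfold_dom_proj.
  + move=> y Rxy; have [_ /= Jy] := rint_dom J R _ Rxy; have [z uz zy] := unfold_surj Jy.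
    by rewrite -zy; apply/IHC => //; apply: h; split=> //=; rewrite zy.
  + by move=> y [_ uy Jxy]; apply/IHC => //; apply: h.
Qed.

(** The projection is injective on violators: a named violator is a nominal or has a critical label,
    since ordinary labels denote non-violators, and a critical label belongs to one individual. *)
Lemma unfolding_vio tau : tau \in tbox T ->
  (vio_incl unfolding tau #<= vio_incl J tau)%card.
Proof.
case: tau => B C Ttau; have [sB sC] : {subset concept_inds B <= tinds} /\
    {subset concept_inds C <= tinds}.
  by split=> a ha; apply/flattenP; exists (inclusion_inds (Sub B C));
    rewrite /= ?mem_cat ?ha ?orbT //; apply/mapP; exists (Sub B C).
have vioP x : vio_incl unfolding (Sub B C) x ->
    unfold_dom x /\ vio_incl J (Sub B C) (unfold_proj x).
  case=> [Bx [/= ux nCx]]; split=> //; split; first exact/(unfolding_ext sB ux).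
  by split; [apply: unfold_dom_proj|move=> /(unfolding_ext sC ux)].
have noord a : unfold_named a -> vio_incl J (Sub B C) (unfold_place a) ->
    a \in tinds \/ exists2 e, critical e & (a, e) \in os.
  move=> [ha|/mapP[[b e] h /= ->]]; first by left.
  rewrite (unfold_place_os h) => v.
  case: e h (os_fits h) v => [s|[t|c]] h [Je /=].
  - by move=> /eqP -> _; left; apply: valP.
  - by move=> _ v; case: (pat_ordinary Je Ttau).
  - by move=> _ _; right; exists (inr (inr c)).
apply: (inj_card_le (f := unfold_proj)) => [x /vioP[]//|].
move=> x y /vioP[ux vx] /vioP[uy vy].
case: x y ux vx uy vy => [a|x] [b|y] /= ux vx uy vy.
- move=> e; congr inl.
  case: (noord a ux vx) => [ha|[e1 c1 h1]].
    by rewrite (unfold_place_nominal ha) in e; rewrite (unfold_place_eq_nominal uy ha).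
  case: (noord b uy vy) => [hb|[e2 c2 h2]].
    by rewrite (unfold_place_nominal hb) in e; apply: unfold_place_eq_nominal.
  move: e; rewrite (unfold_place_os h1) (unfold_place_os h2) => /emb_inj e12.
  by rewrite -e12 in h2; apply: os_crit h1 h2.
- by case: uy => _ /(_ _ ux).
- by case: ux => _ /(_ _ uy) n /esym.
- by move=> ->.
Qed.

Lemma unfolding_sat r : {subset occs r <= os} -> lsat J r ->
  sat_assertion unfolding (unlabel r).
Proof.
case: r => [[s [a e]] o] sub; have ha : (a, e) \in os by apply: sub; rewrite inE eqxx.
have ua : unfold_named a by right; apply/mapP; exists (a, e).
case: o sub => [[b e']|] sub; rewrite /lsat /=.
  have hb : (b, e') \in os by apply: sub; rewrite !inE eqxx orbT.
  have ub : unfold_named b by right; apply/mapP; exists (b, e').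
  by move=> h; split=> //=; rewrite (unfold_place_os ha) (unfold_place_os hb).
by move=> h; split=> //=; rewrite (unfold_place_os ha).
Qed.

End Unfold.

Theorem pattern_sound (J : pattern) (os : seq (iname * label)) :
  (forall o, o \in os -> fits J o) ->
  (forall a e e', (a, e) \in os -> (a, e') \in os -> e = e') ->
  (forall a b e, critical e -> (a, e) \in os -> (b, e) \in os -> a = b) ->
  exists I, [/\ forall a, a \in tinds ++ map fst os -> dom I (inl a),
    (tcost T I <= tcost T J)%E
    & forall r, {subset occs r <= os} -> lsat J r -> sat_assertion I (unlabel r)].
Proof.
move=> h1 h2 h3; exists (unfolding J os); split.
- by move=> a; rewrite mem_cat => /orP[]; [left|right].
- by apply: tcost_le => tau Ttau; apply: unfolding_vio => // a b e; apply: h3.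
- by move=> r; apply: unfolding_sat.
Qed.

(** * From an interpretation of bounded cost to a pattern *)

Section Filtration.
Variable I : interp.
Hypothesis I_nominal : forall a, a \in tinds -> dom I (inl a).
Variable slot : inclusion -> iname + anon I -> 'I_k.+1.
Hypothesis slot_inj : forall tau, tau \in tbox T -> forall x y,
  vio_incl I tau x -> vio_incl I tau y -> slot tau x = slot tau y -> x = y.

Definition ctype (x : iname + anon I) : {ffun 'I_(size (tclosure T)) -> bool} :=
  [ffun i : 'I_(size (tclosure T)) => `[< ext I (nth Top (tclosure T) i) x >]].

Definition nominal_of (x : iname + anon I) : option (seq_sub tinds) :=
  if x is inl a then insub a else None.

Definition vio_of (x : iname + anon I) : option 'I_(size (tbox T)) :=
  [pick i : 'I_(size (tbox T)) | `[< vio_incl I (nth (Sub Top Top) (tbox T) i) x >]].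

Definition label_of (x : iname + anon I) : label :=
  match nominal_of x, vio_of x with
  | Some s, _ => inl s
  | None, Some i => inr (inr (i, slot (nth (Sub Top Top) (tbox T) i) x))
  | None, None => inr (inl (ctype x))
  end.

Lemma nominal_ofP x s : nominal_of x = Some s -> x = inl (val s).
Proof. by case: x => //= a; case: insubP => // u _ <- [<-]. Qed.

Lemma vio_ofP x i : vio_of x = Some i ->
  vio_incl I (nth (Sub Top Top) (tbox T) i) x.
Proof. by rewrite /vio_of; case: pickP => // j /asboolP h [<-]. Qed.

(** A critical label names an inclusion violated by the element, and [slot] separates the violators
    of that inclusion. *)
Lemma label_of_critical x y : critical (label_of x) -> label_of x = label_of y ->
  x = y.
Proof.
rewrite /label_of; case: (nominal_of x) => [s|] //.
case vx: (vio_of x) => [i|] // _; case: (nominal_of y) => [s|] //.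
case vy: (vio_of y) => [j|] // [ij]; rewrite -{}ij in vy *.
by apply: slot_inj (vio_ofP vx) (vio_ofP vy); apply: mem_nth.
Qed.

Lemma label_of_ext x y C : label_of x = label_of y -> C \in tclosure T ->
  ext I C x <-> ext I C y.
Proof.
have [cx|] := boolP (critical (label_of x)).
  by move=> /(label_of_critical cx) ->.
rewrite /label_of; case nx: (nominal_of x) => [s|].
  case ny: (nominal_of y) => [s'|]; last by case: vio_of.
  by move=> _ [ss] _; rewrite (nominal_ofP nx) (nominal_ofP ny) ss.
case: (vio_of x) => // _; case: (nominal_of y) => //; case: (vio_of y) => // -[exy] hC.
have iC : index C (tclosure T) < size (tclosure T) by rewrite index_mem.
move/ffunP: exy => /(_ (Ordinal iC)); rewrite !ffunE /= nth_index // => e.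
by split=> /asboolP h; apply/asboolP; rewrite (e, =^~ e).
Qed.

Definition filt_emb (e : label) : iname + label :=
  match e with inl s => inl (val s) | inr _ => inr e end.

Definition filt_map (x : iname + anon I) := filt_emb (label_of x).

Lemma filt_emb_inj : injective filt_emb.
Proof. by move=> [s|y] [s'|y'] //= [e]; [rewrite (val_inj e)|rewrite e]. Qed.

Lemma filt_nonempty : filt_map @` dom I !=set0.
Proof. by have [x Ix] := dom_nonempty I; exists (filt_map x), x. Qed.

(* Names too long to occur in the TBox get full extensions. *)
Lemma filt_cint_dom A :
  (if size A < name_bound T then filt_map @` cint I A else filt_map @` dom I)
    `<=` filt_map @` dom I.
Proof.
by case: ifP => // _ _ [x Ax <-]; exists x => //; apply: cint_dom Ax.
Qed.

Lemma filt_rint_dom R :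
  (if size R < name_bound T then
     (fun p => (filt_map p.1, filt_map p.2)) @` rint I R
   else (filt_map @` dom I) `*` (filt_map @` dom I))
    `<=` (filt_map @` dom I) `*` (filt_map @` dom I).
Proof.
move=> p; case: ifP => // _ [[x y] Rxy <-]; have [/= Ix Iy] := rint_dom I R _ Rxy.
by split; [exists x|exists y].
Qed.

Definition filtration : interp :=
  @Interp label _ _ _ filt_nonempty filt_cint_dom filt_rint_dom.

(** For names of the closure this is the smallest filtration. An edge leaving the class of [x] stems
    from an edge leaving some [y] of that class; [Exists R C] and [Forall R C] are themselves in the
    closure, so their truth passes between [x] and [y]. *)
Lemma filtration_ext C : {subset subconcepts C <= tclosure T} ->
  forall x, dom I x -> ext filtration C (filt_map x) <-> ext I C x.
Proof.
move=> sub0 x; have hC0 : C \in tclosure T by apply/sub0/subconcepts_refl.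
have subW (s : seq concept) (D : concept) :
    {subset D :: s <= tclosure T} -> {subset s <= tclosure T}.
  by move=> h E hE; apply: h; rewrite inE hE orbT.
have catP (s s' t : seq concept) : {subset s ++ s' <= t} ->
    {subset s <= t} /\ {subset s' <= t}.
  by move=> h; split=> z hz; apply: h; rewrite mem_cat hz ?orbT.
have filtE D : D \in tclosure T -> forall y z, filt_map y = filt_map z ->
    ext I D y -> ext I D z.
  by move=> hD y z /filt_emb_inj /label_of_ext /(_ hD) [].
elim: C x sub0 hC0 => [A|a|||C IHC D IHD|C IHC D IHD|C IHC|R C IHC|R C IHC] x sub0 hC0 Ix.
- have lA := name_bound_gt hC0; rewrite /= in lA; rewrite /= lA.
  split=> [[y Ay e]|Ax]; last by exists x.
  exact: (filtE _ hC0 _ _ e).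
- have ha : a \in tinds by rewrite -nominal_tclosure.
  rewrite /= /filt_map /label_of; split=> [|->] /=.
    case nx: (nominal_of x) => [s|] /=; first by move=> [<-]; apply: nominal_ofP.
    by case: vio_of.
  by rewrite insubT.
- by split=> // _; exists x.
- by [].
- have [sC sD] := catP _ _ _ (subW _ _ sub0).
  have hC := IHC x sC (sC _ (subconcepts_refl _)) Ix.
  have hD := IHD x sD (sD _ (subconcepts_refl _)) Ix.
  by split=> -[/hC ? /hD].
- have [sC sD] := catP _ _ _ (subW _ _ sub0).
  have hC := IHC x sC (sC _ (subconcepts_refl _)) Ix.
  have hD := IHD x sD (sD _ (subconcepts_refl _)) Ix.
  by split=> -[/hC|/hD] ?; [left|right|left|right].
- have sC := subW _ _ sub0; have hC := IHC x sC (sC _ (subconcepts_refl _)) Ix.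
  split=> -[_ n]; split=> //; [by move=> /hC|by exists x|by move=> /hC].
- have sC := subW _ _ sub0; have hC y := IHC y sC (sC _ (subconcepts_refl _)).
  have lR := name_bound_gt hC0; rewrite /= in lR; rewrite /= lR; split.
    case=> _ [_ [[[y z] Ryz [/= exy <-]] Cz]].
    have [/= Iy Iz] := rint_dom I R _ Ryz.
    apply: (filtE _ hC0 _ _ exy); split=> //; exists z; split=> //.
    exact/hC.
  case=> _ [y [Rxy Cy]]; split; first by exists x.
  have [/= _ Iy] := rint_dom I R _ Rxy.
  by exists (filt_map y); split; [exists (x, y)|apply/hC].
- have sC := subW _ _ sub0; have hC y := IHC y sC (sC _ (subconcepts_refl _)).
  have lR := name_bound_gt hC0; rewrite /= in lR; rewrite /= lR; split.
    case=> _ h; split=> // y Rxy; have [/= _ Iy] := rint_dom I R _ Rxy.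
    by apply/hC => //; apply: h; exists (x, y).
  move=> Ax; split; first by exists x.
  move=> _ [[y z] Ryz [/= exy <-]]; have [/= Iy Iz] := rint_dom I R _ Ryz.
  have [_ /(_ z Ryz)] := filtE _ hC0 _ _ (esym exy) Ax.
  by move=> Cz; apply/hC.
Qed.

Lemma filtration_vio tau : tau \in tbox T -> forall x, dom I x ->
  vio_incl filtration tau (filt_map x) -> vio_incl I tau x.
Proof.
case: tau => B C /tclosure_sub[sB sC] x Ix [Bx [_ nC]].
split; first exact/(filtration_ext sB Ix).
by split=> // Cx; apply/nC/(filtration_ext sC Ix).
Qed.

Lemma label_of_emb_other y b : filt_emb (inr y) = inl b -> b \notin tinds.
Proof. by []. Qed.

Lemma filtration_nominal a : a \in tinds -> dom filtration (inl a).
Proof.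
move=> ha; exists (inl a); first exact: I_nominal.
by rewrite /filt_map /label_of /= insubT.
Qed.

Lemma filtration_ordinary t : dom filtration (filt_emb (inr (inl t))) ->
  forall tau, tau \in tbox T -> ~ vio_incl filtration tau (filt_emb (inr (inl t))).
Proof.
move=> [x Ix e] tau Ttau; rewrite -e => /(filtration_vio Ttau Ix) v.
move: e => /filt_emb_inj; rewrite /label_of; case: nominal_of => //.
rewrite /vio_of; case: pickP => // no _.
have it : index tau (tbox T) < size (tbox T) by rewrite index_mem.
by have := no (Ordinal it); rewrite /= nth_index // => /asboolP.
Qed.

Definition filtration_pattern : pattern :=
  @Pattern filtration filt_emb filt_emb_inj (fun=> erefl) label_of_emb_other
    filtration_nominal filtration_ordinary.

Lemma filtration_fits a : dom I (inl a) ->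
  fits filtration_pattern (a, label_of (inl a)).
Proof.
move=> Ia; split; first by exists (inl a).
rewrite /label_of /=; case: insubP => [s _ <-|na] //=.
by case: vio_of.
Qed.

Lemma filtration_lsat r : (forall o, o \in occs r -> o.2 = label_of (inl o.1)) ->
  sat_assertion I (unlabel r) -> lsat filtration_pattern r.
Proof.
case: r => [[s [a e]] o] h; have -> : e = label_of (inl a).
  by apply: (h (a, e)); rewrite inE eqxx.
case: o h => [[b e']|] h; rewrite /lsat /= => sat.
  have -> : e' = label_of (inl b) by apply: (h (b, e')); rewrite !inE eqxx orbT.
  case: ifP => _; first by exists (inl a, inl b).
  have [/= Ia Ib] := rint_dom I s _ sat.
  by split; [exists (inl a)|exists (inl b)].
case: ifP => _; first by exists (inl a).
by exists (inl a) => //; apply: cint_dom sat.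
Qed.

(** Predicates this long may coincide after truncation. Since all assertions on them hold, failure
    of an assertion can still be read off from truncated names. *)
Lemma filtration_long r : name_bound T <= size r.1.1 ->
  (forall o, o \in occs r -> dom filtration (filt_emb o.2)) ->
  lsat filtration_pattern r.
Proof.
case: r => [[s [a e]] o] /=; rewrite leqNgt => /negbTE ls h.
have he : dom filtration (filt_emb e) by apply: (h (a, e)); rewrite inE eqxx.
case: o h => [[b e']|] h; rewrite /lsat /= ls //.
by split=> //; apply: (h (b, e')); rewrite !inE eqxx orbT.
Qed.

End Filtration.

Theorem pattern_complete I : (forall a, a \in tinds -> dom I (inl a)) ->
  (tcost T I <= (k%:Z)%:E)%E ->
  exists (J : pattern) (lab : iname -> label),
  [/\ (tcost T J <= tcost T I)%E,
      forall a, dom I (inl a) -> fits J (a, lab a),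
      forall a b, critical (lab a) -> lab a = lab b -> a = b,
      forall r, (forall o, o \in occs r -> o.2 = lab o.1) ->
        sat_assertion I (unlabel r) -> lsat J r
    & forall r, name_bound T <= size r.1.1 ->
        (forall o, o \in occs r -> fits J o) -> lsat J r].
Proof.
move=> nomI costI.
have /choice[slot slotP] : forall tau, exists f : iname + anon I -> 'I_k.+1,
    tau \in tbox T -> forall x y, vio_incl I tau x -> vio_incl I tau y ->
    f x = f y -> x = y.
  move=> tau; have [Ttau|] := boolP (tau \in tbox T); last by exists (fun=> ord0).
  have [f fP] := ecard_inj (le_trans (ecard_vio_le I Ttau) costI).
  by exists f.
exists (filtration_pattern nomI slotP), (fun a => label_of slot (inl a)); split.
- apply: tcost_le => tau Ttau.
  (* Every violator in the filtration is the image of a violator in [I]. *)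
  apply: card_le_trans (card_image_le (filt_map slot) _).
  apply: subset_card_le => y v.
  have [x Ix exy] : dom (filtration slot) y by case: tau Ttau v => B C _ [_ []].
  exists x => //; apply: (filtration_vio slotP Ttau Ix); first by rewrite exy.
- by move=> a Ia; apply: filtration_fits.
- by move=> a b c /(label_of_critical slotP c) [].
- exact: filtration_lsat.
- by move=> r lr h; apply: filtration_long => // o /h[].
Qed.

End Patterns.

(** * Labelled words *)

HB.instance Definition _ := gen_eqMixin positive.

Lemma letter_eqE (l l' : letter) : (l == l') =
  match l, l' with
  | Zero, Zero | One, One | Infty, Infty | ConceptMark, ConceptMark
  | RoleMark, RoleMark | Comma, Comma | Semicolon, Semicolon => true
  | _, _ => false
  end.
Proof. by case: l l' => -[]; apply/eqP. Qed.

Section LabelledWords.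
Variables (T : wtbox) (k : nat).
Local Notation label := (label T k).
Local Notation aletter := (letter * option label)%type.
Local Notation lassertion := (lassertion T k).
Local Notation lrecord := (lassertion (seq bool) * weight)%type.

Definition plain (l : letter) : aletter := (l, None).
Definition name_word (s : seq bool) : seq aletter := map plain (enc_name s).
(** The label sits on the comma before the name, so that a comparison of two names starts with both
    labels at hand. No other letters are labelled. *)
Definition occ_word (o : seq bool * label) : seq aletter :=
  (Comma, Some o.2) :: name_word o.1.

Definition record_mark (r : lassertion (seq bool)) : aletter :=
  plain (if r.2 is Some _ then RoleMark else ConceptMark).

Definition record_body (x : lrecord) : seq aletter :=
  name_word x.1.1.1 ++ flatten (map occ_word (occs x.1)) ++
  plain Comma :: map plain (enc_weight x.2).

Definition record_word (x : lrecord) : seq aletter :=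
  record_mark x.1 :: record_body x.

Definition records_word (xs : seq lrecord) : seq aletter :=
  flatten [seq rcons (record_word x) (plain Semicolon) | x <- xs].

Definition all_occs (xs : seq lrecord) : seq (seq bool * label) :=
  flatten [seq occs x.1 | x <- xs].

Lemma records_word_cons x xs : records_word (x :: xs) =
  record_mark x.1 :: record_body x ++ plain Semicolon :: records_word xs.
Proof. by rewrite /records_word /= cat_rcons. Qed.

Lemma records_word_cat xs ys :
  records_word (xs ++ ys) = records_word xs ++ records_word ys.
Proof. by rewrite /records_word map_cat flatten_cat. Qed.

Lemma map_fst_plain (s : seq letter) : map fst (map plain s) = s.
Proof. by rewrite -map_comp map_id. Qed.

Lemma map_fst_records_word xs : map fst (records_word xs) =
  flatten [seq enc_assertion (unlabel x.1) ++
               Comma :: rcons (enc_weight x.2) Semicolon | x <- xs].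
Proof.
elim: xs => // x xs IH; rewrite records_word_cons /= map_cat /= IH.
case: x => [[[s [a e]] [[b e']|]] w] /=;
  rewrite /record_body /= !map_cat /= ?cats0 !map_cat /= !map_fst_plain;
  by rewrite -?cats1 -?catA /= -?catA /= -?catA.
Qed.

Definition name_letter (l : letter) := match l with Zero | One => true | _ => false end.

Definition name_start (p : aletter * aletter) :=
  [&& p.1.1 == Comma, p.2.1 == Comma, isSome p.1.2 & isSome p.2.2].
Definition name_continue (p : aletter * aletter) :=
  (p.1.1 == p.2.1) && name_letter p.1.1.
(** Here [q] is the first pair that is not a pair of equal digits. As names are followed by commas,
    the names are equal exactly when the letters of [q] agree. *)
Definition name_clash (p q : aletter * aletter) :=
  if q.1.1 == q.2.1 then p.1.2 != p.2.2
  else (p.1.2 == p.2.2) && (if p.1.2 is Some e then critical e else false).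

Definition mark (l : letter) :=
  match l with ConceptMark | RoleMark => true | _ => false end.

Definition assertion_start (p : aletter * aletter) :=
  (p.1.1 == p.2.1) && mark p.1.1.
(** The unlabelled comma ends the assertion. The weight after it is not compared: one assertion with
    two weights is still a repetition. *)
Definition assertion_continue (p : aletter * aletter) :=
  [&& p.1.1 == p.2.1, ~~ mark p.1.1 & p.1 != plain Comma].
Definition assertion_clash (p q : aletter * aletter) := q.1.1 == q.2.1.

Definition names_tracked := tracked name_start name_continue name_clash.
Definition assertions_tracked :=
  tracked assertion_start assertion_continue assertion_clash.

Lemma name_start_Some e e' : name_start ((Comma, Some e), (Comma, Some e')).
Proof. by rewrite /name_start !eqxx. Qed.

Lemma regular_names_tracked : regular names_tracked.
Proof.
apply: regular_tracked => -[[l x] [l' x']]; rewrite /name_start /name_continue /=.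
by case/andP=> /eqP -> /andP[/eqP -> _]; rewrite andbF.
Qed.

Lemma regular_assertions_tracked : regular assertions_tracked.
Proof.
apply: regular_tracked => -[[l x] [l' x']].
by rewrite /assertion_start /assertion_continue /= => /andP[-> ->].
Qed.

(** One induction for both comparisons; [clash] is the verdict on distinct names, depending on the
    labels for individuals and always [false] inside assertions. *)
Lemma follow_name (co : pred (aletter * aletter)) bad (clash : bool) p a b x y s t :
  (forall l, name_letter l -> co (plain l, plain l)) ->
  (forall q, co q -> q.1.1 == q.2.1) ->
  (forall q, q.1.1 != q.2.1 -> bad p q = clash) ->
  follow co bad p (zip (name_word a ++ (Comma, x) :: s)
                       (name_word b ++ (Comma, y) :: t)) =
  if a == b then follow co bad p (((Comma, x), (Comma, y)) :: zip s t)
  else ~~ clash.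
Proof.
move=> co_bit co_eq bad_ne.
have diff q (z : bool) : q.1.1 != q.2.1 -> (if co q then z else ~~ bad p q) = ~~ clash.
  move=> ne; case: ifP => [/co_eq e|_]; first by rewrite e in ne.
  by rewrite bad_ne.
elim: a b => [|c a IH] [|d b]; rewrite /name_word /= ?eqxx //.
- by rewrite (diff (_, _)) //= letter_eqE; case: d.
- by rewrite (diff (_, _)) //= letter_eqE; case: c.
rewrite eqseq_cons; have [<-|ncd] := eqVneq c d.
  rewrite -/(plain _) co_bit; last by case: c.
  exact: IH.
by rewrite (diff (_, _)) //= letter_eqE; case: c d ncd => -[].
Qed.

Lemma follow_names e e' a b x y s t :
  follow name_continue name_clash ((Comma, Some e), (Comma, Some e'))
    (zip (name_word a ++ (Comma, x) :: s) (name_word b ++ (Comma, y) :: t)) =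
  if a == b then e == e' else ~~ ((e == e') && critical e).
Proof.
rewrite (@follow_name _ _ ((e == e') && critical e)).
- by rewrite /= /name_continue /= andbF /name_clash eqxx /= negbK (inj_eq Some_inj).
- by move=> l h; rewrite /name_continue /= eqxx.
- by move=> q /andP[].
- by move=> q /negbTE ne; rewrite /name_clash ne /= (inj_eq Some_inj).
Qed.

Lemma follow_assertions p x y s t : record_mark x.1 = record_mark y.1 ->
  follow assertion_continue assertion_clash p
    (zip (record_body x ++ s) (record_body y ++ t)) =
  (unlabel x.1 != unlabel y.1).
Proof.
have co_bit l : name_letter l -> assertion_continue (plain l, plain l).
  by case: l => // _; rewrite /assertion_continue /= eqxx xpair_eqE letter_eqE.
have co_eq q : assertion_continue q -> q.1.1 == q.2.1 by case/and3P.
have bad_ne q : q.1.1 != q.2.1 -> assertion_clash p q = false by move/negbTE.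
have names := @follow_name _ _ false p _ _ _ _ _ _ co_bit co_eq bad_ne.
have step e e' z : follow assertion_continue assertion_clash p
    (((Comma, Some e), (Comma, Some e')) :: z) =
    follow assertion_continue assertion_clash p z.
  by rewrite [LHS]/= /assertion_continue eqxx xpair_eqE /= andbF.
have stop z : follow assertion_continue assertion_clash p
    (((Comma, None), (Comma, None)) :: z) = false.
  by rewrite [LHS]/= /assertion_continue !eqxx /= /assertion_clash eqxx.
case: x y => [[[r [a e]] [[b e1]|]] w] [[[r' [a' e']] [[b' e1']|]] w'] // _;
  rewrite /record_body ![flatten _]/= ?cats0 /occ_word -!catA !cat_cons -?catA ?cat_cons
    names step names ?step ?names stop.
  have -> : (RAssert r a b == RAssert r' a' b') = [&& r == r', a == a' & b == b'].
    by apply/eqP/and3P => [[-> -> ->]|[/eqP -> /eqP -> /eqP ->]].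
  by do 3!case: eqVneq.
have -> : (CAssert r a == CAssert r' a') = (r == r') && (a == a').
  by apply/eqP/andP => [[-> ->]|[/eqP -> /eqP ->]].
by do 2!case: eqVneq.
Qed.

(** * From shifts of a word to pairs of positions *)

Definition shifts_tracked (tr : seq (aletter * aletter) -> bool) u : Prop :=
  forall d, 0 < d <= size u -> tr (zip (drop d u) u).

Lemma drop_zip (B C : Type) n (s : seq B) (t : seq C) :
  drop n (zip s t) = zip (drop n s) (drop n t).
Proof. by elim: n s t => [|n IH] [|x s] [|y t] //=; rewrite ?drop0 ?IH //; case: drop. Qed.

(** The shift by the distance of two suffixes aligns them, and a tracked word stays tracked when
    letters are dropped in front. *)
Lemma shifts_tracked_pair st co bad u s s' t t' :
  shifts_tracked (tracked st co bad) u -> u = s ++ t -> u = s' ++ t' ->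
  size s' < size s -> tracked st co bad (zip t t').
Proof.
move=> tr us us' lt; set d := size s - size s'.
have d_ok : 0 < d <= size u by rewrite us size_cat /d; lia.
have /(tracked_drop (size s')) := tr d d_ok.
rewrite drop_zip drop_drop /d subnKC ?(ltnW lt) // {1}us us'.
by rewrite !drop_size_cat.
Qed.

Lemma name_word_inj a b x y s t :
  name_word a ++ (Comma, x) :: s = name_word b ++ (Comma, y) :: t -> a = b.
Proof.
elim: a b => [|c a IH] [|d b] //=; rewrite /name_word /=.
- by case: d.
- by case: c.
by case: c d => -[] // [/IH ->].
Qed.

Lemma all_occs_word xs o : o \in all_occs xs ->
  exists s y t, records_word xs = s ++ occ_word o ++ (Comma, y) :: t.
Proof.
elim: xs => // x xs IH; rewrite -[all_occs _]/(occs x.1 ++ all_occs xs) mem_cat => /orP[|/IH[s [y [t e]]]].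
  rewrite records_word_cons /record_body.
  case: x => [[[r o1] [o2|]] w] /=; rewrite !inE.
    case/orP=> /eqP ->.
      exists (record_mark (r, o1, Some o2) :: name_word r); do 2!eexists.
      by rewrite /= ?cats0 -?catA /= -?catA /= -?catA /=.
    exists (record_mark (r, o1, Some o2) :: name_word r ++ occ_word o1); do 2!eexists.
    by rewrite /= ?cats0 -?catA /= -?catA /= -?catA /=.
  move=> /eqP ->.
  exists (record_mark (r, o1, None) :: name_word r); do 2!eexists.
  by rewrite /= ?cats0 -?catA /= -?catA /= -?catA /=.
exists (record_mark x.1 :: record_body x ++ plain Semicolon :: s), y, t.
by rewrite records_word_cons e /= -!catA.
Qed.

Lemma names_tracked_consistent xs : shifts_tracked names_tracked (records_word xs) ->
  forall a b e e', (a, e) \in all_occs xs -> (b, e') \in all_occs xs ->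
    if a == b then e == e' else ~~ ((e == e') && critical e).
Proof.
move=> tr a b e e' /all_occs_word[s [y [t E]]] /all_occs_word[s' [y' [t' E']]].
have [lt|lt|eqs] := ltngtP (size s) (size s').
- have /andP[/implyP/(_ (name_start_Some _ _))] := shifts_tracked_pair tr E' E lt.
  rewrite -/(name_word _) follow_names [b == a]eq_sym [e' == e]eq_sym.
  by case: eqVneq => // _; case: eqVneq => // ->.
- have /andP[/implyP/(_ (name_start_Some _ _))] := shifts_tracked_pair tr E E' lt.
  by rewrite -/(name_word _) follow_names.
(* At equal positions the two occurrences are the same one. *)
have /eqP := E; rewrite E' eqseq_cat // => /andP[_ /eqP[-> /name_word_inj ->]].
by rewrite !eqxx.
Qed.

Lemma assertions_tracked_uniq xs :
  shifts_tracked assertions_tracked (records_word xs) ->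
  uniq [seq unlabel x.1 | x <- xs].
Proof.
move=> tr; suff: forall ys s, records_word xs = s ++ records_word ys ->
    uniq [seq unlabel x.1 | x <- ys] by move=> /(_ xs [::] erefl).
elim=> //= x ys IH s E; rewrite (IH (s ++ rcons (record_word x) (plain Semicolon))).
  rewrite andbT; apply/negP => /mapP[y yin exy]; case/splitPr: yin {IH} E => ys1 ys2 E.
  have E' : records_word xs = (s ++ records_word (x :: ys1)) ++ records_word (y :: ys2).
    by rewrite E -catA -records_word_cat.
  have lt : size s < size (s ++ records_word (x :: ys1)).
    by rewrite size_cat records_word_cons /=; lia.
  have := shifts_tracked_pair tr E' E lt; rewrite !records_word_cons /=.
  have em : record_mark y.1 = record_mark x.1.
    by move: exy; case: (x) (y) => [[[r [a e]] [[b e1]|]] w] [[[r' [a' e']] [[b' e1']|]] w'].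
  rewrite -em {1}/assertion_start eqxx /= follow_assertions // exy eqxx implybF.
  by case: (y) => [[? [?|]] ?].
by rewrite E records_word_cons -catA cat_rcons.
Qed.

(** Serves the converse direction: wherever a track starts, the letters that follow spell a whole
    occurrence or a whole record. *)
Fixpoint suffixes_all (P : aletter -> seq aletter -> Prop) (u : seq aletter) : Prop :=
  if u is a :: u' then P a u' /\ suffixes_all P u' else True.

Lemma suffixes_all_drop P u n a s : suffixes_all P u -> drop n u = a :: s -> P a s.
Proof. by elim: u n => [|b u IH] [|n] //= [Pb /IH h]; [case=> <- <-|apply: h]. Qed.

Definition content_letter (l : letter) := match l with Zero | One | Infty => true | _ => false end.

Lemma suffixes_all_content P (s : seq letter) t :
  (forall l u, content_letter l -> P (plain l) u) -> all content_letter s ->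
  suffixes_all P t -> suffixes_all P (map plain s ++ t).
Proof. by move=> h; elim: s => //= l s IH /andP[hl /IH hs] /hs; split=> //; apply: h. Qed.

Lemma content_enc_name s : all content_letter (enc_name s).
Proof. by elim: s => //= -[]. Qed.

Lemma content_enc_weight w : all content_letter (enc_weight w).
Proof. by case: w => //; elim=> //= p IH; rewrite all_rcons IH. Qed.

Lemma suffixes_all_records P xs :
  (forall l u, content_letter l -> P (plain l) u) ->
  (forall u, P (plain Comma) u) -> (forall u, P (plain Semicolon) u) ->
  (forall x ys s, xs = s ++ x :: ys ->
     P (record_mark x.1) (record_body x ++ plain Semicolon :: records_word ys) /\
     forall o y t, o \in occs x.1 -> P (Comma, Some o.2) (name_word o.1 ++ (Comma, y) :: t)) ->
  suffixes_all P (records_word xs).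
Proof.
move=> hcont hcomma hsemi; elim: xs => // x xs IH hx; rewrite records_word_cons.
have {}IH : suffixes_all P (records_word xs).
  by apply: IH => y ys s e; apply: (hx y ys (x :: s)); rewrite e.
have [hm ho] := hx x xs [::] erefl; split=> //.
have hw : suffixes_all P (map plain (enc_weight x.2) ++ plain Semicolon :: records_word xs).
  by apply: suffixes_all_content => //; exact: content_enc_weight.
move: ho; rewrite /record_body -?catA; case: x {hx hm} hw => [[[r o1] [o2|]] w] hw ho /=.
  apply: suffixes_all_content => //; first exact: content_enc_name.
  split; first by rewrite -?catA; apply: ho; rewrite !inE eqxx.
  rewrite -?catA; apply: suffixes_all_content => //; first exact: content_enc_name.
  split; first by apply: ho; rewrite !inE eqxx orbT.
  by apply: suffixes_all_content => //; first exact: content_enc_name.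
apply: suffixes_all_content => //; first exact: content_enc_name.
split; first by rewrite -?catA; apply: ho; rewrite !inE eqxx.
by rewrite -?catA; apply: suffixes_all_content => //; first exact: content_enc_name.
Qed.

Lemma consistent_names_tracked xs :
  (forall a b e e', (a, e) \in all_occs xs -> (b, e') \in all_occs xs ->
    if a == b then e == e' else ~~ ((e == e') && critical e)) ->
  shifts_tracked names_tracked (records_word xs).
Proof.
move=> cons.
pose P (c : aletter) u := forall e, c = (Comma, Some e) ->
  exists a y t, u = name_word a ++ (Comma, y) :: t /\ (a, e) \in all_occs xs.
have sufP : suffixes_all P (records_word xs).
  apply: suffixes_all_records => //.
  move=> x ys s E; split=> [e|o y t ho e [<-]]; first by case: (x) => [[? [?|]] ?].
  exists o.1, y, t; split=> //; apply/flattenP; exists (occs x.1).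
    by apply/mapP; exists x => //; rewrite E mem_cat inE eqxx orbT.
  by case: o ho.
move=> d _; apply: trackedP => n [c c'] z; rewrite drop_zip drop_drop.
case e1: (drop _ _) => [|c1 u1]; first by case: (drop n _).
case e2: (drop n _) => [|c2 u2] //= [<- <- <-] {c c' z}.
case: c1 c2 e1 e2 => [l1 [x1|]] [l2 [x2|]] e1 e2; rewrite /name_start /= ?andbF // ?andbT.
case/andP=> /eqP el1 /eqP el2; subst l1 l2.
have [a [y [t [-> ha]]]] := suffixes_all_drop sufP e1 _ erefl.
have [b [y' [t' [-> hb]]]] := suffixes_all_drop sufP e2 _ erefl.
by rewrite follow_names; apply: cons.
Qed.

Lemma uniq_assertions_tracked xs : uniq [seq unlabel x.1 | x <- xs] ->
  shifts_tracked assertions_tracked (records_word xs).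
Proof.
move=> un.
pose P (c : aletter) u := mark c.1 ->
  exists s x ys, [/\ xs = s ++ x :: ys, c = record_mark x.1
    & u = record_body x ++ plain Semicolon :: records_word ys].
have sufP : suffixes_all P (records_word xs).
  apply: suffixes_all_records => //; first by case.
  by move=> x ys s E; split=> // _; exists s, x, ys.
move=> d /andP[d0 _]; apply: trackedP => n [c c'] z; rewrite drop_zip drop_drop.
case e1: (drop _ _) => [|c1 u1]; first by case: (drop n _).
case e2: (drop n _) => [|c2 u2] //= [<- <- <-] {c c' z}.
rewrite /assertion_start /= => /andP[/eqP e12 m1].
have [s [x [ys [E ex eu]]]] := suffixes_all_drop sufP e1 m1.
have [s' [x' [ys' [E' ex' eu']]]] := suffixes_all_drop sufP e2 (etrans (congr1 _ (esym e12)) m1).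
rewrite eu eu' follow_assertions; last first.
  by case: (x) (x') ex ex' e12 => [[? [?|]] ?] [[? [?|]] ?] -> ->.
(* As the shift is positive, the two marks stand at different positions and thus belong to different
   records. *)
have ne : size s != size s'.
  apply/eqP => ess; have /eqP := E; rewrite E' eqseq_cat; last by rewrite ess.
  case/andP=> _ /eqP[exx eyy].
  have := congr1 size e1; have := congr1 size e2.
  rewrite !size_drop /= eu eu' exx eyy; lia.
have sx : size s < size xs by rewrite E size_cat /=; lia.
have sx' : size s' < size xs by rewrite E' size_cat /=; lia.
have nthE s0 x0 ys0 : xs = s0 ++ x0 :: ys0 ->
    nth (unlabel x.1) [seq unlabel x.1 | x <- xs] (size s0) = unlabel x0.1.
  move=> ->; rewrite (nth_map x) ?nth_cat ?ltnn ?subnn //= size_cat /=; lia.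
by rewrite -(nthE _ _ _ E) -(nthE _ _ _ E') nth_uniq ?size_map.
Qed.

End LabelledWords.

(** * Recognising labelled words *)

Definition capped (k n : nat) : 'I_k.+2 := inord (minn n k.+1).

Lemma val_capped k n : capped k n = minn n k.+1 :> nat.
Proof. by rewrite /capped inordK // ltnS geq_minr. Qed.

(** Against a budget of at most [k], an infinite weight acts like [k.+1]. *)
Definition weight_nat (k : nat) (w : weight) : nat :=
  if w is Some p then nat_of_pos p else k.+1.

Section Recognition.
Variables (T : wtbox) (k : nat).
Local Notation label := (label T k).
Local Notation aletter := (letter * option label)%type.
Local Notation lassertion := (lassertion T k).
Local Notation lrecord := (lassertion (seq bool) * weight)%type.
Local Notation M := (name_bound T).
Local Notation name_word := (@name_word T k).
Local Notation plain := (@plain T k).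
Local Notation content := (bool * M.-bseq aletter * 'I_k.+2)%type.
Local Notation aname := (M.-bseq bool).

Definition name_aletter (a : aletter) := (a.2 == None) && name_letter a.1.

Definition digit_step (n : 'I_k.+2) (a : aletter) : 'I_k.+2 :=
  capped k (n.*2 + (a.1 == One)).

(** Whether a block is a name or a weight depends on its place in the record, so the data for both
    readings are collected from every block. *)
Definition content_of (s : seq aletter) : content :=
  (all name_aletter s, trunc M s, foldl digit_step (capped k 0) s).

Lemma regular_content_of : regular content_of.
Proof.
apply: regular_pair; last exact: regular_foldl.
by apply: regular_pair; [apply: regular_all|apply: regular_trunc].
Qed.

Definition content_name (c : content) : aname :=
  trunc M [seq a.1 == One | a <- (c.1.2 : seq aletter)].

Definition content_weight (c : content) : option 'I_k.+2 :=
  if (c.1.2 : seq aletter) == [:: plain Infty] then Some (capped k k.+1)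
  else if c.1.1 && (ohead (c.1.2 : seq aletter) == Some (plain One)) then Some c.2
  else None.

Definition weight_word w : seq aletter := map plain (enc_weight w).

Lemma name_aletter_word a : all name_aletter (name_word a).
Proof. by elim: a => //= -[]. Qed.

Lemma name_wordK s : all name_aletter s ->
  s = name_word [seq a.1 == One | a <- s].
Proof.
elim: s => //= -[l [x|]] s IH /andP[] // h /IH {1}->.
by congr (_ :: _); case: l h => // _; rewrite letter_eqE.
Qed.

Lemma name_word_map a : [seq a.1 == One | a <- name_word a] = a.
Proof. by elim: a => //= -[] a ->; rewrite letter_eqE. Qed.

Lemma content_nameE a : content_name (content_of (name_word a)) = trunc M a.
Proof.
apply: val_inj; rewrite /= !val_trunc map_take name_word_map.
by rewrite -take_min minnn.
Qed.

Lemma content_of_nil s : content_of s = content_of [::] -> s = [::].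
Proof. by case=> _ e _; apply/esym; apply: (@trunc_short _ M). Qed.

Lemma digits_pos p : foldl digit_step (capped k 0) (map plain (enc_pos p)) =
  capped k (nat_of_pos p).
Proof.
(* Doubling and adding a digit never leads back below the cap, so capping early does not change the
   result. *)
have step n (b : bool) : digit_step (capped k n) (plain (if b then One else Zero)) =
    capped k (n.*2 + b).
  apply: val_inj; rewrite /= /digit_step /= !val_capped.
  by case: b; rewrite letter_eqE /=; lia.
elim: p => [p IH|p IH|] /=; last by rewrite (step 0 true).
- by rewrite map_rcons foldl_rcons IH (step _ true) addn1 NatTrec.doubleE.
- by rewrite map_rcons foldl_rcons IH (step _ false) addn0 NatTrec.doubleE.
Qed.

Lemma name_aletter_pos p : all name_aletter (map plain (enc_pos p)).
Proof. by elim: p => //= p IH; rewrite map_rcons all_rcons IH. Qed.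

Lemma ohead_trunc (s : seq aletter) : ohead (trunc M s) = ohead s.
Proof. by rewrite val_trunc; case: s. Qed.

Lemma ohead_pos p : ohead (map plain (enc_pos p)) = Some (plain One).
Proof.
by elim: p => //= p IH; rewrite map_rcons -cats1; case: (map _ _) IH.
Qed.

Lemma content_weightE w :
  content_weight (content_of (weight_word w)) = Some (capped k (weight_nat k w)).
Proof.
rewrite /content_weight /=; case: w => [p|]; last by rewrite val_trunc eqxx.
rewrite ohead_trunc /weight_word /= ohead_pos name_aletter_pos eqxx /=.
case: eqP => [e|_]; last by rewrite digits_pos.
by have := ohead_trunc (map plain (enc_pos p)); rewrite e ohead_pos => -[].
Qed.

(** A digit string with leading [One] is a numeral; since [enc_pos] appends the lowest digit, the
    induction removes the last letter. *)
Lemma content_weight_sound s c : content_weight (content_of s) = Some c ->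
  exists2 w, s = weight_word w & c = capped k (weight_nat k w).
Proof.
rewrite /content_weight /=; case: eqP => [e [<-]|_].
  exists None => //; apply/esym; apply: (@trunc_short _ M) => //.
  by apply: val_inj; rewrite /= e val_trunc.
rewrite ohead_trunc; case: ifP => // /andP[alls /eqP hs] [<-].
suff [p ->] : exists p, s = map plain (enc_pos p).
  by exists (Some p) => //; rewrite digits_pos.
elim/last_ind: s alls hs => // s a IH; rewrite all_rcons => /andP[ha alls].
case: s IH alls => [|b s] IH alls h.
  by exists xH; move: h => /= [->].
have [||p ep] := IH => //; rewrite ep.
case: a ha {h} => l [] // /andP[_]; case: l => // _.
- by exists (xO p); rewrite /= map_rcons.
- by exists (xI p); rewrite /= map_rcons.
Qed.

Definition abstract (r : lassertion (seq bool)) : lassertion aname :=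
  (trunc M r.1.1, (trunc M r.1.2.1, r.1.2.2),
   if r.2 is Some be then Some (trunc M be.1, be.2) else None).

Local Notation verdict := (option (lassertion aname * 'I_k.+2)).

(** A block is paired with the delimiter that ends it, so the label of an individual is found one
    block before its name. *)
Definition verdict_of (ts : seq (content * aletter)) (c : content) : verdict :=
  if content_weight c isn't Some n then None else
  match ts with
  | [:: t0; (c1, (l1, Some e)); t2] =>
      if [&& (t0.1 == content_of [::]) && (t0.2 == plain ConceptMark), l1 == Comma,
             t2.2 == plain Comma, c1.1.1 & t2.1.1.1]
      then Some ((content_name c1, (content_name t2.1, e), None), n) else None
  | [:: t0; (c1, (l1, Some e)); (c2, (l2, Some e')); t3] =>
      if [&& (t0.1 == content_of [::]) && (t0.2 == plain RoleMark), l1 == Comma, l2 == Comma,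
             t3.2 == plain Comma, c1.1.1, c2.1.1 & t3.1.1.1]
      then Some ((content_name c1, (content_name c2, e),
                  Some (content_name t3.1, e')), n) else None
  | _ => None
  end.

Definition delimiter (a : aletter) :=
  match a.1 with ConceptMark | RoleMark | Comma => true | _ => false end.

(** A record has three or four delimited blocks, so looking at five is enough to notice a
    surplus. *)
Definition record_verdict (s : seq aletter) : verdict :=
  let p := blocks delimiter s in
  verdict_of (trunc 5 [seq (content_of b.1, b.2) | b <- p.1]) (content_of p.2).

Lemma regular_record_verdict : regular record_verdict.
Proof.
have h := regular_blocks delimiter regular_content_of
  (@regular_trunc (content * aletter)%type 5).
exact: (regular_comp (fun p => verdict_of (bseqval p.1) p.2) h).
Qed.

Lemma record_verdict_sound s x : record_verdict s = Some x ->
  exists r w, s = record_word (r, w) /\ x = (abstract r, capped k (weight_nat k w)).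
Proof.
have := blocksK delimiter s; rewrite /record_verdict.
case: (blocks delimiter s) => bs l <-; rewrite /unblocks [(_, l).2]/= /verdict_of val_trunc.
case ew: content_weight => [n|] //.
have [w -> ->] := content_weight_sound ew.
have name t : all name_aletter t -> exists2 a, t = name_word a &
    content_name (content_of t) = trunc M a.
  by move=> /name_wordK e; eexists; [exact: e|rewrite {1}e content_nameE].
case: bs => [|[b0 a0] [|[b1 [l1 [e|]]] [|[b2 a2] bs]]] //.
case: bs => [|[b3 a3] [|[b4 a4] bs]] /=; last by case: a2 => ? [].
- case: a2 => l2 [o2|]; case: ifP => //; first by case/and5P=> _ _ /eqP.
  move=> /and5P[/andP[/eqP/content_of_nil-> /eqP ->] /eqP -> /eqP -> /name[r -> ->] /name[a -> ->]] [<-].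
  exists (r, (a, e), None), w; split=> //.
  by rewrite /record_word /record_body /= !cats0 -!cats1 -?catA /= -?catA.
- case: a2 => l2 [e'|] //; case: ifP => //.
  case/and5P=> /andP[/eqP/content_of_nil-> /eqP ->] /eqP -> /eqP -> /eqP ->.
  move=> /and3P[/name[r -> ->] /name[a -> ->] /name[b -> ->]] [<-].
  exists (r, (a, e), Some (b, e')), w; split=> //.
  by rewrite /record_word /record_body /= !cats0 -!cats1 -?catA /= -?catA /= -?catA.
Qed.

Lemma record_verdict_word r w : record_verdict (record_word (r, w)) =
  Some (abstract r, capped k (weight_nat k w)).
Proof.
have free a : all (predC delimiter) (name_word a) by elim: a => //= -[].
have freew : all (predC delimiter) (weight_word w).
  by rewrite /weight_word; case: w => //; elim=> //= p IH; rewrite map_rcons all_rcons IH.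
have blk bs b a s : all (predC delimiter) b -> delimiter a ->
    blocks_from delimiter (bs, [::]) (b ++ a :: s) =
    blocks_from delimiter (rcons bs (b, a), [::]) s.
  by move=> fb da; rewrite blocks_from_cat.
rewrite /record_verdict /blocks /record_word /record_body.
have -> : forall u, record_mark r :: u = [::] ++ record_mark r :: u by [].
rewrite blk //; last by case: (r) => [[? ?] [?|]].
case: r => [[r [a e]] [[b e']|]] /=; rewrite ?cats0 -?catA /= !blk //=
  -/(weight_word w) blocks_from_free //= /verdict_of content_weightE val_trunc /=.
  by rewrite !eqxx !name_aletter_word /= !content_nameE.
by rewrite !eqxx !name_aletter_word /= !content_nameE.
Qed.

End Recognition.

(** * Guessing a pattern *)

(** A weight above the budget [m] is fatal with or without the cap, which exceeds [m]; a smaller one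
    is exact and is subtracted from the budget. *)
Lemma sum_weight_le k (ws : seq weight) m : m <= k ->
  (\sum_(w <- ws) weight_val w <= (m%:Z)%:E)%E =
  (\sum_(w <- ws) capped k (weight_nat k w) <= m).
Proof.
have ge0 (s : seq weight) : (0 <= \sum_(w <- s) weight_val w)%E.
  by apply: sume_ge0 => w _; exact/ltW/weight_val_gt0.
elim: ws m => [|w ws IH] m mk; first by rewrite !big_nil lee_fin.
rewrite !big_cons val_capped; case: w => [p|] /=; last first.
  rewrite addye; last by have := ge0 ws; case: (\sum_(w <- ws) _)%E.
  by rewrite leye_eq minnn; apply/esym/negbTE; rewrite -ltnNge ltn_addr.
have [le_pm|lt_mp] := leqP (nat_of_pos p) m; last first.
  have -> : (minn (nat_of_pos p) k.+1 + \sum_(w <- ws) capped k (weight_nat k w) <= m) = false.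
    by apply/negbTE; rewrite -ltnNge; lia.
  apply/negbTE; rewrite -ltNge; apply: lt_le_trans (leeDl _ (ge0 ws)).
  by rewrite lte_fin ltz_nat.
rewrite addeC -leeBrDr // -EFinB subzn // IH; lia.
Qed.

Section Guess.
Variables (T : wtbox) (k : nat).
Local Notation label := (label T k).
Local Notation aletter := (letter * option label)%type.
Local Notation lassertion := (lassertion T k).
Local Notation lrecord := (lassertion (seq bool) * weight)%type.
Local Notation M := (name_bound T).
Local Notation aname := (M.-bseq bool).
Local Notation verdict := (option (lassertion aname * 'I_k.+2)).

(* [W] collects the abstract assertions admitted by some pattern, [V] those
   among them that it may violate, and [c] bounds its TBox cost. *)
Definition realizable (W V : {set lassertion aname}) (c : nat) : Prop :=
  exists J : pattern T k, [/\ (tcost T J <= (c%:Z)%:E)%E,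
    forall r, abstract r \in W -> forall o, o \in occs r -> fits J o
    & forall r, abstract r \in W -> ~ lsat J r -> abstract r \in V].

Definition admitted (W : {set lassertion aname}) (v : verdict) :=
  if v is Some x then x.1 \in W else false.

Definition charge (V : {set lassertion aname}) (v : verdict) : nat :=
  if v is Some x then if x.1 \in V then nat_of_ord x.2 else 0 else 0.

Definition total_charge (V : {set lassertion aname}) : seq verdict -> 'I_k.+2 :=
  foldl (fun (n : 'I_k.+2) v => capped k (n + charge V v)) (capped k 0).

Lemma total_chargeE V vs :
  total_charge V vs = minn (\sum_(v <- vs) charge V v) k.+1 :> nat.
Proof.
elim/last_ind: vs => [|vs v IH]; first by rewrite big_nil val_capped.
rewrite /total_charge foldl_rcons val_capped -/(total_charge V vs) IH big_rcons /=; lia.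
Qed.

Definition affordable (vs : seq verdict) : Prop := exists W V c,
  [/\ realizable W V c, all (admitted W) vs & c + total_charge V vs <= k].

(** There are finitely many [W] and [V], so a state can tabulate admission and charge for all of
    them; realizability does not depend on the word. *)
Lemma regular_affordable : regular affordable.
Proof.
exists ({ffun {set lassertion aname} -> bool} *
        {ffun {set lassertion aname} -> 'I_k.+2})%type.
exists (fun vs => ([ffun W => all (admitted W) vs], [ffun V => total_charge V vs])).
split=> vs vs'.
  move=> v [/ffunP e1 /ffunP e2]; congr (_, _); apply/ffunP => W.
    by have := e1 W; rewrite !ffunE !all_rcons => ->.
  by have := e2 W; rewrite !ffunE /total_charge !foldl_rcons => ->.
move=> [/ffunP e1 /ffunP e2]; rewrite /affordable; apply/propext.
by split=> -[W [V [c]]]; have := e1 W; have := e2 V; rewrite !ffunE => e e';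
  rewrite (e, =^~ e) (e', =^~ e') => h; exists W, V, c.
Qed.

Definition semicolon (a : aletter) := a == plain T k Semicolon.

(** [all pred0] excludes an unfinished record in a form already known to be regular. *)
Definition well_labelled (u : seq aletter) : Prop :=
  let p := blocks semicolon u in
  affordable [seq record_verdict b.1 | b <- p.1] /\ all pred0 p.2.

Lemma regular_well_labelled : regular well_labelled.
Proof.
have h := regular_blocks semicolon
  (regular_pair (@regular_record_verdict T k) (regular_all pred0))
  (regular_map (fun x : verdict * bool * aletter => x.1.1) regular_affordable).
apply: regular_ext (regular_comp (fun p => p.1 /\ is_true p.2.2) h) => s.
by rewrite /well_labelled /= -map_comp.
Qed.

Definition record_charge (V : {set lassertion aname}) (xs : seq lrecord) : nat :=
  \sum_(x <- xs | abstract x.1 \in V) capped k (weight_nat k x.2).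

Lemma well_labelledP u : well_labelled u <->
  exists xs, u = records_word xs /\ exists W V c,
  [/\ realizable W V c, all (fun x => abstract x.1 \in W) xs
    & c + record_charge V xs <= k].
Proof.
pose vd (x : lrecord) : verdict := Some (abstract x.1, capped k (weight_nat k x.2)).
have cond xs : affordable (map vd xs) <-> exists W V c,
    [/\ realizable W V c, all (fun x => abstract x.1 \in W) xs
      & c + record_charge V xs <= k].
  have sumE V : \sum_(v <- map vd xs) charge V v = record_charge V xs.
    by rewrite big_map /record_charge [RHS]big_mkcond.
  split=> -[W [V [c [r a s]]]]; exists W, V, c; split=> //.
  - by move: a; rewrite all_map.
  - by move: s; rewrite total_chargeE sumE; lia.
  - by rewrite all_map.
  - by rewrite total_chargeE sumE; lia.
split=> [[aff l0]|[xs [-> /cond aff]]].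
  have del := blocks_delim semicolon u; have eu := blocksK semicolon u.
  move: (blocks semicolon u) aff l0 del eu => [bs l] /= aff l0 del eu.
  have {l0 l}eu : u = flatten [seq rcons b.1 b.2 | b <- bs].
    by rewrite -eu /unblocks; case: (l) l0 => //; rewrite cats0.
  suff [xs [e1 e2]] : exists xs, flatten [seq rcons b.1 b.2 | b <- bs] = records_word xs
      /\ [seq record_verdict b.1 | b <- bs] = map vd xs.
    by exists xs; rewrite eu e1; split=> //; apply/cond; rewrite -e2.
  have [W [_ [_ [_ aW _]]]] := aff.
  elim: bs del aW {aff eu} => [|[b a] bs IH] /=; first by exists [::].
  case/andP=> /eqP -> /IH{}IH /andP[+ /IH[xs [e1 e2]]].
  case ev: record_verdict => [x|] // _.
  have [r [w [eb ex]]] := record_verdict_sound ev.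
  by exists ((r, w) :: xs); rewrite /= e1 e2 eb ex.
have free x : all (predC semicolon) (record_word x).
  have plainF l : l != Semicolon -> ~~ semicolon (plain T k l).
    by rewrite /semicolon xpair_eqE eqxx andbT.
  have nameF a : all (predC semicolon) (name_word T k a).
    by elim: a => //= b a ->; rewrite andbT; apply: plainF; rewrite letter_eqE; case: b.
  have weightF w : all (predC semicolon) (map (plain T k) (enc_weight w)).
    case: w => [|] /=; last by rewrite plainF // letter_eqE.
    by elim=> [p IH|p IH|] /=; rewrite ?map_rcons ?all_rcons /= ?IH ?plainF // letter_eqE.
  have commaF e : ~~ semicolon (Comma, e) by rewrite /semicolon xpair_eqE letter_eqE.
  case: x => [[[r [a e]] [[b e']|]] w]; rewrite /record_word /record_body /=;
    rewrite ?cats0 ?all_cat /= ?all_cat /= ?all_cat /= ?nameF ?weightF ?commaF ?plainF ?letter_eqE //.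
have blk ys p : blocks_from semicolon (p, [::]) (records_word ys) =
    (p ++ [seq (record_word x, plain T k Semicolon) | x <- ys], [::]).
  elim: ys p => [|y ys IH] p; first by rewrite cats0.
  rewrite (_ : records_word _ = record_word y ++ plain T k Semicolon :: records_word ys).
    by rewrite blocks_from_cat ?free //; [rewrite IH cat_rcons|exact: eqxx].
  by rewrite records_word_cons.
rewrite /well_labelled /blocks blk /=; split=> //.
rewrite -map_comp.
by rewrite (@eq_map _ _ _ vd) // => -[r w] /=; rewrite record_verdict_word.
Qed.

(** * Weighted ABoxes and their labelled records *)

Lemma wkb_cost (A : wabox) I : cost (WKB T A) I =
  (tcost T I + \sum_(w <- [seq aweight A alpha | alpha <- vio_abox I (abox A)])
     weight_val w)%E.
Proof. by rewrite /cost big_map. Qed.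

Lemma records_sound xs W V c : realizable W V c ->
  all (fun x => abstract x.1 \in W) xs -> c + record_charge V xs <= k ->
  (forall a b e e', (a, e) \in all_occs xs -> (b, e') \in all_occs xs ->
    if a == b then e == e' else ~~ ((e == e') && critical e)) ->
  uniq [seq unlabel x.1 | x <- xs] ->
  exists A, map fst (records_word xs) = enc_wabox A /\ BCS (WKB T A) k.
Proof.
move=> [J [costJ fitJ satJ]] /allP allW charge_le cons un.
have [|||I [domI costI satI]] := @pattern_sound T k J (all_occs xs).
- by move=> o /flattenP[_ /mapP[x /allW xW ->]]; apply: fitJ.
- by move=> a e e' h h'; have := cons _ _ _ _ h h'; rewrite eqxx => /eqP.
- move=> a b e ce h h'; have := cons _ _ _ _ h h'.
  by rewrite eqxx ce; case: eqP.
(* Weights are looked up in the records; [un] makes the lookup unambiguous. *)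
pose wt alpha := nth None (unzip2 xs) (index alpha [seq unlabel x.1 | x <- xs]).
have wtE x : x \in xs -> wt (unlabel x.1) = x.2.
  move=> /[dup] xin /(nthP x)[i lt_i ei]; rewrite /wt.
  have -> : unlabel x.1 = nth (unlabel x.1) [seq unlabel x.1 | x <- xs] i.
    by rewrite (nth_map x) // ei.
  by rewrite index_uniq ?size_map // (nth_map x) // ei.
exists (WABox _ wt un); split.
  rewrite map_fst_records_word /enc_wabox /= -map_comp; congr flatten.
  by apply/eq_in_map => x /wtE /= ->.
exists I; split.
  move=> a; rewrite /wkb_inds mem_cat /= => ha; apply: domI; rewrite mem_cat.
  case/orP: ha => [->//|/flattenP[_ /mapP[_ /mapP[x xin ->] ->] ha]].
  apply/orP; right; move: ha; rewrite assertion_inds_occs => /mapP[o ho ->].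
  by apply: map_f; apply/flattenP; exists (occs x.1) => //; apply: map_f.
rewrite wkb_cost /vio_abox /= filter_map -!map_comp.
have ck : c <= k by apply: leq_trans charge_le; apply: leq_addr.
have -> : (k%:Z)%:E = ((c%:Z)%:E + ((k - c)%:Z)%:E)%E.
  by rewrite -EFinD -PoszD subnKC.
apply: leeD; first exact: le_trans costI costJ.
rewrite (sum_weight_le (k := k)) ?leq_subr //.
apply: leq_trans (_ : record_charge V xs <= _); last by lia.
rewrite big_map big_filter /record_charge big_seq_cond [leqRHS]big_seq_cond.
rewrite [leqLHS]big_mkcond [leqRHS]big_mkcond; apply: leq_sum => x _.
case: (boolP (x \in xs)) => //= xin; case: asboolP => // nsat.
(* An assertion that fails in [I] already fails in the pattern, so it is in [V] and has been
   charged. *)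
rewrite (wtE _ xin) (satJ x.1) //; first exact: allW.
move=> ls; apply: nsat; apply: satI ls => o ho.
by apply/flattenP; exists (occs x.1) => //; apply: (map_f (fun x => occs x.1)).
Qed.

(** [fits] inspects a name only to test it against nominals of the TBox, which are shorter than the
    truncation. *)
Lemma abstract_fits (J : pattern T k) r r' : abstract r = abstract r' ->
  (forall o, o \in occs r -> fits J o) -> forall o, o \in occs r' -> fits J o.
Proof.
have fitE a a' e : trunc M a = trunc M a' -> fits J (a, e) -> fits J (a', e).
  move=> eM [Je h]; split=> //; move: h; case: e {Je} => [s|y] /=.
    move=> /eqP ea; apply/eqP; rewrite -ea; apply/esym; apply: trunc_short eM.
    rewrite ea; have := name_bound_gt (C := Nominal (val s)); apply.
    by rewrite nominal_tclosure; apply: valP.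
  apply: contra => ha'; suff -> : a = a' by [].
  apply/esym; apply: trunc_short (esym eM).
  by have := name_bound_gt (C := Nominal a'); apply; rewrite nominal_tclosure.
case: r r' => [[s [a e]] o] [[s' [a' e']] o'] [_ ea <- eo] h z.
rewrite inE => /orP[/eqP ->|].
  by apply: fitE ea _; apply: h; rewrite inE eqxx.
case: o o' eo h => [[b e1]|] [[b' e1']|] //= [eb <-] h; rewrite inE => /eqP ->.
by apply: fitE eb _; apply: h; rewrite !inE eqxx orbT.
Qed.

Lemma records_complete (A : wabox) : BCS (WKB T A) k ->
  exists xs W V c, map fst (records_word xs) = enc_wabox A /\
  [/\ realizable W V c, all (fun x => abstract x.1 \in W) xs,
      c + record_charge V xs <= k,
      (forall a b e e', (a, e) \in all_occs xs -> (b, e') \in all_occs xs ->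
        if a == b then e == e' else ~~ ((e == e') && critical e))
    & uniq [seq unlabel x.1 | x <- xs]].
Proof.
case=> I [domI]; rewrite wkb_cost => costI.
have acost_ge0 : (0 <= \sum_(w <- [seq aweight A alpha | alpha <- vio_abox I (abox A)])
     weight_val w)%E by apply: sume_ge0 => w _; exact/ltW/weight_val_gt0.
have tcost_ge0 : (0 <= tcost T I)%E.
  by apply: sume_ge0 => tau _; apply: mule_ge0; [exact/ltW/weight_val_gt0|exact: ecard_ge0].
have tcost_k : (tcost T I <= (k%:Z)%:E)%E := le_trans (leeDl _ acost_ge0) costI.
have [c ec] : exists c : nat, tcost T I = (c%:Z)%:E.
  by case: (tcost T I) tcost_ge0 tcost_k => [[c|//]| |] // _ _; exists c.
have ck : c <= k by move: tcost_k; rewrite ec lee_fin lez_nat.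
have [|J [lab [costJ fitJ critJ satJ longJ]]] := pattern_complete (k := k) _ tcost_k.
  by move=> a ha; apply: domI; rewrite /wkb_inds mem_cat ha.
pose lbl alpha : lassertion (seq bool) := match alpha with
  | CAssert s a => (s, (a, lab a), None)
  | RAssert s a b => (s, (a, lab a), Some (b, lab b)) end.
have lblK alpha : unlabel (lbl alpha) = alpha by case: alpha.
have lbl_lab alpha o : o \in occs (lbl alpha) -> o.2 = lab o.1.
  by case: alpha => [s a|s a b]; rewrite !inE; [move=> /eqP ->|case/orP=> /eqP ->].
pose xs : seq lrecord := [seq (lbl alpha, aweight A alpha) | alpha <- abox A].
have unE : [seq unlabel x.1 | x <- xs] = abox A.
  by rewrite -map_comp -[RHS]map_id; apply: eq_map => alpha /=; rewrite lblK.
have fit_lbl alpha : alpha \in abox A -> forall o, o \in occs (lbl alpha) -> fits J o.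
  move=> hA o ho; have -> : o = (o.1, lab o.1) by rewrite -(lbl_lab _ _ ho); case: (o).
  apply: fitJ; apply: domI; rewrite /wkb_inds mem_cat; apply/orP; right.
  apply/flattenP; exists (assertion_inds alpha); first by apply: map_f.
  by rewrite -[alpha]lblK assertion_inds_occs; apply: map_f.
pose W := [set x | `[< exists2 r, abstract r = x & forall o, o \in occs r -> fits J o >]]%SET.
pose V := [set x | `[< exists r, [/\ abstract r = x, forall o, o \in occs r -> fits J o
                                 & ~ lsat J r] >]]%SET.
have WE r : abstract r \in W -> forall o, o \in occs r -> fits J o.
  by rewrite inE => /asboolP[r' e h]; apply: abstract_fits e h.
(* Failure is visible on the abstract record: [lsat] depends on the predicate and the labels, a
   short predicate survives truncation, and a long one never fails on fitting individuals. *)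
have VE r : abstract r \in V -> ~ lsat J r.
  rewrite inE => /asboolP[r' [e fr' ns] sr]; apply: ns.
  have [long|short] := leqP M (size r'.1.1); first exact: longJ.
  move: e sr; case: r r' short {fr'} => [[s [a e]] o] [[s' [a' e']] o'] /= short.
  move=> [es _ <- eo]; rewrite (trunc_short short es) /lsat /=.
  by case: o o' eo => [[b e1]|] [[b' e1']|] //= [_ <-].
exists xs, W, V, c; split.
  rewrite map_fst_records_word /enc_wabox /= -map_comp; congr flatten.
  by apply: eq_map => alpha /=; rewrite lblK.
split.
- exists J; split; [by rewrite -ec|exact: WE|move=> r rW ns].
  by rewrite inE; apply/asboolP; exists r; split=> //; apply: WE.
- rewrite all_map; apply/allP => alpha hA /=; rewrite inE; apply/asboolP.
  by exists (lbl alpha) => //; apply: fit_lbl.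
- suff : record_charge V xs <= k - c by lia.
  have le_kc : k - c <= k := leq_subr _ _.
  apply: leq_trans (_ : \sum_(w <- [seq aweight A alpha | alpha <- vio_abox I (abox A)])
    capped k (weight_nat k w) <= _); last first.
    rewrite -(sum_weight_le _ le_kc).
    move: costI; rewrite ec addeC -leeBrDr // -EFinB subzn //.
  rewrite /record_charge !big_map big_filter [leqLHS]big_mkcond [leqRHS]big_mkcond.
  apply: leq_sum => alpha _ /=; case: ifP => // aV; case: asboolP => // /contrapT sat.
  case: (VE _ aV); apply: satJ; last by rewrite lblK.
  exact: lbl_lab.
- have labE a e : (a, e) \in all_occs xs -> e = lab a.
    by case/flattenP=> _ /mapP[_ /mapP[alpha _ ->] ->] /= /lbl_lab.
  move=> a b e e' /labE -> /labE ->; case: eqVneq => [->|nab]; first by rewrite eqxx.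
  apply/negP => /andP[/eqP eab cr]; move/eqP: nab; apply.
  exact: critJ cr eab.
- by rewrite unE; apply: abox_uniq.
Qed.

End Guess.

Lemma NP_set0 (Sigma : finType) : NP (set0 : set (seq Sigma)).
Proof.
have regF (A : finType) : regular (fun _ : seq A => False).
  by exists unit, (fun=> tt); split.
have -> : set0 = [set w | exists u : seq (Sigma * unit), [/\ map fst u = w, False &
    forall d, 0 < d <= size u -> False]].
  by apply/seteqP; split=> // w [u []].
exact: shift_NP (regF _) (regF _).
Qed.

Theorem theorem8 (T : wtbox) (k : int) : NP (BCS_data T k).
Proof.
(* For a negative bound the language is empty, costs being nonnegative. *)
case: k => k; last first.
  suff -> : BCS_data T (Negz k) = set0 by exact: NP_set0.
  apply/seteqP; split=> // w [A [_ [I [_]]]]; rewrite leNgt => /negP; apply.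
  apply: (@lt_le_trans _ _ 0%E); first by rewrite lte_fin.
  apply: adde_ge0; last by apply: sume_ge0 => w' _; exact/ltW/weight_val_gt0.
  by apply: sume_ge0 => tau _; apply: mule_ge0; [exact/ltW/weight_val_gt0|exact: ecard_ge0].
have reg2 : regular (fun z : seq ((letter * option (label T k)) *
      (letter * option (label T k))) => is_true (names_tracked z) /\ is_true (assertions_tracked z)).
  exact: (regular_comp (fun p => is_true p.1 /\ is_true p.2)
    (regular_pair (@regular_names_tracked T k) (@regular_assertions_tracked T k))).
have NPL := shift_NP (@regular_well_labelled T k) reg2.
suff -> : BCS_data T k = [set w | exists u : seq (letter * option (label T k)),
    [/\ map fst u = w, well_labelled u & forall d, 0 < d <= size u ->
        names_tracked (zip (drop d u) u) /\ assertions_tracked (zip (drop d u) u)]] by [].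
apply/seteqP; split=> w.
  move=> [A [-> /records_complete[xs [W [V [c [e [re aW ch cons un]]]]]]]].
  exists (records_word xs); split=> //.
    by apply/well_labelledP; exists xs; split=> //; exists W, V, c.
  move=> d hd; split; first exact: consistent_names_tracked cons d hd.
  exact: uniq_assertions_tracked un d hd.
move=> [u [<- /well_labelledP[xs [eu [W [V [c [re aW ch]]]]]] tr]].
rewrite eu in tr *.
apply: records_sound re aW ch _ _.
  by apply: names_tracked_consistent => d /tr[].
by apply: assertions_tracked_uniq => d /tr[].
Qed.
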